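(* Let $G_{4,1}$ be the graph with the $12$ vertices $1,2,3,4_0,4_1,4_2,5_0,5_1,5_2,6_0,6_1,6_2$ and the following $24$ edges: $\{1,2\},\{1,3\},\{2,3\}$; $\{4_1,4_0\},\{4_0,4_2\},\{5_1,5_0\},\{5_0,5_2\},\{6_1,6_0\},\{6_0,6_2\}$; $\{4_1,5_2\},\{5_1,6_2\},\{6_1,4_2\}$; $\{1,4_1\},\{2,4_1\},\{2,4_2\},\{3,4_2\},\{2,5_1\},\{3,5_1\},\{3,5_2\},\{1,5_2\},\{3,6_1\},\{1,6_1\},\{1,6_2\},\{2,6_2\}$. Then the $\mathrm{LS}_+$-rank of $G_{4,1}$ is $4$.
   Context: All graphs are finite, simple and undirected. For a graph $G$, a stable set is a set of pairwise nonadjacent vertices; $\mathrm{STAB}(G)\subseteq\mathbb{R}^{V(G)}$ is the convex hull of the incidence vectors of stable sets of $G$, and $\mathrm{FRAC}(G)=\{x\in[0,1]^{V(G)}: x_i+x_j\le 1 \text{ for all } \{i,j\}\in E(G)\}$. For $P\subseteq[0,1]^n$ let $\mathrm{cone}(P)=\{(\lambda,\lambda x)\in\mathbb{R}^{n+1}:\lambda\ge 0, x\in P\}$, with coordinates indexed by $0,1,\dots,n$. Let $\widehat{\mathrm{LS}}_+(P)$ be the set of symmetric positive semidefinite $(n+1)\times(n+1)$ matrices $Y$ with $Ye_0=\mathrm{diag}(Y)$ and $Ye_i,\ Y(e_0-e_i)\in\mathrm{cone}(P)$ for all $i\in[n]$, and $\mathrm{LS}_+(P)=\{x\in\mathbb{R}^n:\exists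 Y\in\widehat{\mathrm{LS}}_+(P),\ Ye_0=(1,x)\}$. Set $\mathrm{LS}_+^0(P)=P$, $\mathrm{LS}_+^k(P)=\mathrm{LS}_+(\mathrm{LS}_+^{k-1}(P))$, and $\mathrm{LS}_+^k(G)=\mathrm{LS}_+^k(\mathrm{FRAC}(G))$. The $\mathrm{LS}_+$-rank $r_+(G)$ of $G$ is the least integer $k\ge 0$ with $\mathrm{LS}_+^k(G)=\mathrm{STAB}(G)$. *)

(* Defs.v *)
From HB Require Import structures.
From mathcomp Require Import all_boot all_order all_algebra.
From mathcomp Require Import boolp classical_sets reals.

Set Implicit Arguments.
Unset Strict Implicit.
Unset Printing Implicit Defensive.

Import Order.TTheory GRing.Theory Num.Theory.
Local Open Scope classical_set_scope.
Local Open Scope ring_scope.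

(** Finite simple graphs on the vertex set 'I_n, so that R^{V(G)} is 'cV[R]_n. *)
Record sgraph (n : nat) := SGraph {
  adj :> rel 'I_n;
  adj_sym : symmetric adj;
  adj_irrefl : irreflexive adj }.

Definition stable n (G : sgraph n) (S : {set 'I_n}) : Prop :=
  forall i j, i \in S -> j \in S -> ~~ G i j.

Section LSplus.
Variable R : realType.

Definition convex_hull (V : lmodType R) (A : set V) : set V :=
  [set x | exists (k : nat) (w : 'I_k -> R) (v : 'I_k -> V),
     [/\ forall i, 0 <= w i, \sum_i w i = 1, forall i, A (v i)
       & x = \sum_i w i *: v i]].

Definition incidence n (S : {set 'I_n}) : 'cV[R]_n := \col_i (i \in S)%:R.

Definition STAB n (G : sgraph n) : set 'cV[R]_n :=
  convex_hull [set x | exists2 S, stable G S & x = incidence S].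

Definition FRAC n (G : sgraph n) : set 'cV[R]_n :=
  [set x | (forall i, 0 <= x i 0 <= 1) /\
           (forall i j, G i j -> x i 0 + x j 0 <= 1)].

(** Vectors of R^{n+1} have type 'cV_(1 + n): coordinate 0 is [lshift n 0] and
    coordinate i of [n] is [rshift 1 i]; (a, x) is [col_mx a%:M x]. *)
Definition cone n (P : set 'cV[R]_n) : set 'cV[R]_(1 + n) :=
  [set y | exists (a : R) (x : 'cV[R]_n),
     [/\ 0 <= a, P x & y = col_mx a%:M (a *: x)]].

Definition e0 n : 'cV[R]_(1 + n) := delta_mx (lshift n 0) 0.
Definition e_ n (i : 'I_n) : 'cV[R]_(1 + n) := delta_mx (rshift 1 i) 0.

Definition diagv n (Y : 'M[R]_n) : 'cV[R]_n := \col_i Y i i.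

Definition sym_psd n (Y : 'M[R]_n) : Prop :=
  Y^T = Y /\ forall z : 'cV[R]_n, 0 <= (z^T *m Y *m z) 0 0.

Definition LSplus_hat n (P : set 'cV[R]_n) : set 'M[R]_(1 + n) :=
  [set Y | [/\ sym_psd Y,
               Y *m e0 n = diagv Y
             & forall i : 'I_n,
                 cone P (Y *m e_ i) /\ cone P (Y *m (e0 n - e_ i))]].

Definition LSplus n (P : set 'cV[R]_n) : set 'cV[R]_n :=
  [set x | exists2 Y, LSplus_hat P Y & Y *m e0 n = col_mx 1%:M x].

Definition LSplus_iter n (k : nat) (G : sgraph n) : set 'cV[R]_n :=
  iter k (@LSplus n) (FRAC G).

Definition is_LSplus_rank n (G : sgraph n) (k : nat) : Prop :=
  LSplus_iter k G = STAB G /\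
  forall j, (j < k)%N -> LSplus_iter j G <> STAB G.

End LSplus.

(** [v4_1] stands for the vertex 4_1 and so on. *)
Definition v1   : 'I_12 := @Ordinal 12 0 isT.
Definition v2   : 'I_12 := @Ordinal 12 1 isT.
Definition v3   : 'I_12 := @Ordinal 12 2 isT.
Definition v4_0 : 'I_12 := @Ordinal 12 3 isT.
Definition v4_1 : 'I_12 := @Ordinal 12 4 isT.
Definition v4_2 : 'I_12 := @Ordinal 12 5 isT.
Definition v5_0 : 'I_12 := @Ordinal 12 6 isT.
Definition v5_1 : 'I_12 := @Ordinal 12 7 isT.
Definition v5_2 : 'I_12 := @Ordinal 12 8 isT.
Definition v6_0 : 'I_12 := @Ordinal 12 9 isT.
Definition v6_1 : 'I_12 := @Ordinal 12 10 isT.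
Definition v6_2 : 'I_12 := @Ordinal 12 11 isT.

Definition G41_edges : seq ('I_12 * 'I_12) :=
  [:: (v1, v2); (v1, v3); (v2, v3);
      (v4_1, v4_0); (v4_0, v4_2);
      (v5_1, v5_0); (v5_0, v5_2);
      (v6_1, v6_0); (v6_0, v6_2);
      (v4_1, v5_2); (v5_1, v6_2); (v6_1, v4_2);
      (v1, v4_1); (v2, v4_1); (v2, v4_2); (v3, v4_2);
      (v2, v5_1); (v3, v5_1); (v3, v5_2); (v1, v5_2);
      (v3, v6_1); (v1, v6_1); (v1, v6_2); (v2, v6_2)].

Definition G41_adj : rel 'I_12 :=
  fun i j => ((i, j) \in G41_edges) || ((j, i) \in G41_edges).

Fact G41_sym : symmetric G41_adj.
Proof. by move=> i j; rewrite /G41_adj orbC. Qed.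

Fact G41_irrefl : irreflexive G41_adj.
Proof.
move=> i; rewrite /G41_adj orbb; apply/negP.
by have /allP no_loop : all (fun e => e.1 != e.2) G41_edges by [];
  move/no_loop; rewrite /= eqxx.
Qed.

Definition G41 : sgraph 12 := SGraph G41_sym G41_irrefl.

(* Main.v *)
Require Import Defs.
From Stdlib Require Import ZArith.
From mathcomp Require Import all_boot all_order all_algebra.
From mathcomp Require Import boolp classical_sets reals.
From mathcomp Require Import lra ring zify ssrZ.

(** Upper bound. For x in LS_+(P) with certificate Y, and a nonnegative
    inequality a.x <= b valid for STAB(G), the column Ye_i satisfies the
    inequality as soon as P satisfies the valid inequalities supported off the
    closed neighbourhood of i; positive semidefiniteness of Y, applied to
    (b, -a), then gives a.x <= b. A vertex with at most one neighbour in the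
    support can be split off with an edge inequality, so each LS_+ step removes
    at least three vertices from the support: LS_+^k(G) = STAB(G) as soon as
    |V(G)| <= 3k + 2.

    Lower bound. All stable sets of G_{4,1} have at most 4 vertices, but LS_+^3
    contains a point with coordinate sum above 4. Membership is certified by
    integer matrices. In the level 3 matrix, up to automorphism, each column
    Ye_i or Y(e_0 - e_i) is either a conic combination of incidence vectors of
    stable sets or the first column of one of three level 2 matrices; the
    columns of these are treated likewise with 22 level 1 matrices. *)

Set Implicit Arguments.
Unset Strict Implicit.
Unset Printing Implicit Defensive.

Import Order.TTheory GRing.Theory Num.Theory.
Local Open Scope classical_set_scope.
Local Open Scope ring_scope.

(** * Convex sets, cones and Farkas' lemma *)

Section Convexity.
Variable R : realType.

Definition convex (V : lmodType R) (P : set V) : Prop :=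
  forall x y (a : R), 0 <= a <= 1 -> P x -> P y -> P (a *: x + (1 - a) *: y).

Lemma coneP n (P : set 'cV[R]_n) (u : 'cV[R]_(1 + n)) (a : R) :
  0 < a -> cone P u -> u (lshift n 0) 0 = a ->
  exists2 x, P x & u = col_mx a%:M (a *: x).
Proof.
move=> a0 [b [x [b0 Px ->]]]; rewrite col_mxEu mxE eqxx mulr1n => <-.
by exists x.
Qed.

Lemma cone1 n (P : set 'cV[R]_n) (x : 'cV[R]_n) :
  cone P (col_mx 1%:M x) <-> P x.
Proof.
split=> [Cx|Px]; last by exists 1, x; split => //; rewrite scale1r.
have [|y Py] := coneP ltr01 Cx; first by rewrite col_mxEu mxE.
by rewrite scale1r => /eq_col_mx[_ ->].
Qed.

Lemma cone_scale n (P : set 'cV[R]_n) (b : R) (u : 'cV[R]_(1 + n)) :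
  0 <= b -> cone P u -> cone P (b *: u).
Proof.
move=> b0 [a [x [a0 Px ->]]]; exists (b * a), x; split; rewrite ?mulr_ge0 //.
by rewrite scale_col_mx scale_scalar_mx scalerA.
Qed.

Lemma cone_sub n (P Q : set 'cV[R]_n) : P `<=` Q -> cone P `<=` cone Q.
Proof. by move=> PQ u [a [x [a0 Px ->]]]; exists a, x; split => //; apply: PQ. Qed.

Lemma cone0 n (P : set 'cV[R]_n) (x : 'cV[R]_n) : P x -> cone P 0.
Proof.
by move=> Px; exists 0, x; split => //; rewrite scale0r raddf0 col_mx0.
Qed.

(** Dividing by [a + b] turns the sum into a convex combination of [x] and [y]; if [a + b = 0], both
    vectors are 0. *)
Lemma convex_coneD n (P : set 'cV[R]_n) (u v : 'cV[R]_(1 + n)) :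
  convex P -> cone P u -> cone P v -> cone P (u + v).
Proof.
move=> cvxP [a [x [a0 Px ->]]] [b [y [b0 Py ->]]].
have [ab0|abN0] := eqVneq (a + b) 0.
  have aE : a = 0 by lra.
  have bE : b = 0 by lra.
  by rewrite aE bE !scale0r raddf0 col_mx0 addr0; apply: cone0 Px.
have ab0 : 0 < a + b by rewrite lt_neqAle eq_sym abN0 addr_ge0.
exists (a + b), (a / (a + b) *: x + (1 - a / (a + b)) *: y); split.
- exact: ltW.
- apply: cvxP => //; rewrite divr_ge0 ?(ltW ab0) //=.
  by rewrite ler_pdivrMr // mul1r lerDl.
- rewrite add_col_mx -raddfD /=; congr col_mx.
  by rewrite scalerDr !scalerA; congr (_ *: _ + _ *: _); field.
Qed.

Lemma convex_cone_sum n (P : set 'cV[R]_n) k (u : 'I_k -> 'cV[R]_(1 + n)) x :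
  convex P -> P x -> (forall i, cone P (u i)) -> cone P (\sum_i u i).
Proof.
move=> cvxP Px Cu; apply: (big_ind (cone P)) => //; first exact: cone0 Px.
by move=> v w; apply: convex_coneD.
Qed.

(** Homogenizing turns a convex combination into a sum of elements of the cone, so no weights have
    to be renormalized along an induction. *)
Lemma convex_hull_sub n (A P : set 'cV[R]_n) :
  convex P -> A `<=` P -> convex_hull A `<=` P.
Proof.
move=> cvxP AP x [k [w [v [w0 w1 Av ->]]]]; apply/cone1.
have -> : col_mx 1%:M (\sum_i w i *: v i) =
    \sum_i w i *: col_mx 1%:M (v i) :> 'cV[R]_(1 + n).
  apply/colP => i; rewrite summxE; case: (split_ordP i) => l ->.
    rewrite [l]ord1 col_mxEu mxE mulr1n -[LHS]w1; apply: eq_bigr => m _.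
    by rewrite mxE col_mxEu mxE mulr1.
  rewrite col_mxEd summxE; apply: eq_bigr => m _.
  by rewrite [in RHS]mxE col_mxEd mxE.
case: k w v w0 w1 Av => [|k] w v w0 w1 Av.
  by move: w1; rewrite big_ord0 => /eqP; rewrite eq_sym oner_eq0.
apply: (convex_cone_sum (x := v ord0)) => // [|i]; first exact: AP.
by apply: cone_scale => //; apply/cone1/AP.
Qed.

Lemma convex_hull_convex (V : lmodType R) (A : set V) : convex (convex_hull A).
Proof.
move=> x y a /andP[a0 a1] [k [w [v [w0 w1 Av ->]]]] [l [w' [v' [w0' w1' Av' ->]]]].
exists (k + l)%N, (fun i => match split i with inl j => a * w j | inr j => (1 - a) * w' j end),
  (fun i => match split i with inl j => v j | inr j => v' j end); split.
- by move=> i; case: splitP => j _; rewrite mulr_ge0 // subr_ge0.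
- rewrite big_split_ord /=.
  under eq_bigr do rewrite (unsplitK (inl _)).
  under [X in _ + X]eq_bigr do rewrite (unsplitK (inr _)).
  by rewrite -!mulr_sumr w1 w1' !mulr1 addrC subrK.
- by move=> i; case: split.
- rewrite big_split_ord /=.
  under [in RHS]eq_bigr do rewrite (unsplitK (inl _)) -scalerA.
  under [X in _ = _ + X]eq_bigr do rewrite (unsplitK (inr _)) -scalerA.
  by rewrite -!scaler_sumr.
Qed.

Lemma convex_hull_incl (V : lmodType R) (A : set V) : A `<=` convex_hull A.
Proof.
move=> x Ax; exists 1%N, (fun=> 1), (fun=> x); split=> //.
  by rewrite big_ord1.
by rewrite big_ord1 scale1r.
Qed.

End Convexity.

Section Farkas.
Variables (R : realType) (d : nat).
Implicit Types (u b y : 'cV[R]_d) (us : seq 'cV[R]_d).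

Fixpoint conic_comb us b : Prop :=
  if us is u :: us' then exists2 c : R, 0 <= c & conic_comb us' (b - c *: u)
  else b = 0.

Let dot y u : R := (y^T *m u) 0 0.

Let dotBr y u v : dot y (u - v) = dot y u - dot y v.
Proof. by rewrite /dot mulmxBr !mxE. Qed.

Let dotZr y u c : dot y (c *: u) = c * dot y u.
Proof. by rewrite /dot -scalemxAr !mxE. Qed.

Let dotBl y z u : dot (y - z) u = dot y u - dot z u.
Proof. by rewrite /dot linearB /= mulmxBl !mxE. Qed.

Let dotZl y u c : dot (c *: y) u = c * dot y u.
Proof. by rewrite /dot linearZ /= -scalemxAl !mxE. Qed.

(** If [b - f b *: u] combines the [v - f v *: u] with coefficients e_v >= 0, then [b] combines the
    [v] with the same coefficients, and [u] receives [f b] minus the sum of the e_v [f v], which is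
    nonnegative. *)
Lemma conic_comb_proj us b u (f : 'cV[R]_d -> R) :
  (forall v, v \in us -> f v <= 0) -> 0 <= f b ->
  conic_comb [seq v - f v *: u | v <- us] (b - f b *: u) ->
  conic_comb (u :: us) b.
Proof.
move=> fus fb Hb.
(* The coefficient [c] of [u] varies along the induction; each [v] adds [- e * f v >= 0] to it, so
   it can only grow. *)
suff H c : conic_comb [seq v - f v *: u | v <- us] (b - c *: u) ->
    exists2 c', c <= c' & conic_comb us (b - c' *: u).
  by have [c' cc' Hc'] := H _ Hb; exists c' => //; apply: le_trans cc'.
elim: us b c fus {fb Hb} => [|v us IH] b c fus /=; first by exists c.
move=> [e e0]; have fv : f v <= 0 by apply: fus; rewrite inE eqxx.
have -> : b - c *: u - e *: (v - f v *: u) = b - e *: v - (c - e * f v) *: u.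
  by apply/matrixP => i j; rewrite !mxE; ring.
move=> /IH[w uw|c' cc' H]; first by apply: fus; rewrite inE uw orbT.
exists c'; first by apply: le_trans cc'; rewrite lerDl oppr_ge0 mulr_ge0_le0.
by exists e => //; rewrite addrAC.
Qed.

(** Induction on the number of generators. If the hypothesis holds without [u], then [u] gets
    coefficient 0. Otherwise some [y] is nonpositive on [us] and positive at [b], hence positive at
    [u], and all vectors are projected along [u] onto the hyperplane orthogonal to [y]. *)
Lemma farkas us b :
  (forall y, (forall u, u \in us -> (y^T *m u) 0 0 <= 0) -> (y^T *m b) 0 0 <= 0) ->
  conic_comb us b.
Proof.
have [m] := ubnP (size us); elim: m us b => // m IH [|u us] b /= szus H.
  (* Without generators, the hypothesis at [y = b] bounds the squared norm of [b] by 0. *)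
  have : dot b b <= 0 by apply: H.
  rewrite /dot mxE => bb; apply/matrixP => i j; rewrite [j]ord1 [RHS]mxE.
  have := bb; rewrite le_eqVlt ltNge sumr_ge0 ?orbF; last first.
    by move=> k _; rewrite mxE -expr2 sqr_ge0.
  rewrite psumr_eq0 => [/allP/(_ i)|k _]; last by rewrite mxE -expr2 sqr_ge0.
  by rewrite mem_index_enum => /(_ isT) /=; rewrite mxE mulf_eq0 orbb => /eqP.
have [Hb|] := pselect (forall y, (forall v, v \in us -> dot y v <= 0) -> dot y b <= 0).
  by exists 0 => //; rewrite scale0r subr0; apply: IH.
move=> /existsNP[y /not_implyP[yus /negP]]; rewrite -ltNge => yb.
have yu : 0 < dot y u.
  rewrite ltNge; apply/negP => yu; move: yb; rewrite ltNge => /negP; apply; apply: H => v.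
  by rewrite inE => /predU1P[->//|]; apply: yus.
pose f v := dot y v / dot y u.
apply: (@conic_comb_proj _ _ _ f) => [v vus||].
- by rewrite /f mulr_le0_ge0 ?invr_ge0 ?yus // ltW.
- by rewrite divr_ge0 // ltW.
apply: IH => [|z zus]; first by rewrite size_map.
(* This is the transpose of the projection: corrected by a multiple of [y], the vector [z] becomes
   orthogonal to [u] and takes at [v] the value of [z] at the projected [v]. *)
have E v : dot (z - (dot z u / dot y u) *: y) v = dot z (v - f v *: u).
  by rewrite dotBl dotZl dotBr dotZr /f; ring.
rewrite -/(dot _ _) -E; apply: H => v; rewrite inE => /predU1P[->|vus].
  by rewrite -/(dot _ _) E dotBr dotZr /f divff ?gt_eqF // mul1r subrr.
by rewrite -/(dot _ _) E; apply: zus; apply: map_f.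
Qed.

End Farkas.

(** * Properties of LS_+ *)

Section LSplusTheory.
Variables (R : realType) (n : nat).
Implicit Types (P Q : set 'cV[R]_n) (G : sgraph n) (Y : 'M[R]_(1 + n)).

Lemma LSplus_hatD P Y1 Y2 a b : convex P -> 0 <= a -> 0 <= b ->
  LSplus_hat P Y1 -> LSplus_hat P Y2 -> LSplus_hat P (a *: Y1 + b *: Y2).
Proof.
move=> cvxP a0 b0 [[sY1 pY1] dY1 cY1] [[sY2 pY2] dY2 cY2].
split=> [||i]; [split => [|z]| |].
- by rewrite linearD !linearZ /= sY1 sY2.
- rewrite mulmxDr mulmxDl -!scalemxAr -!scalemxAl mxE [X in X + _]mxE [X in _ + X]mxE.
  by rewrite addr_ge0 // mulr_ge0.
- rewrite mulmxDl -!scalemxAl dY1 dY2.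
  by apply/matrixP => i j; rewrite !mxE.
have [c1 c1'] := cY1 i; have [c2 c2'] := cY2 i.
by rewrite !mulmxDl -!scalemxAl; split; apply: convex_coneD => //; apply: cone_scale.
Qed.

Lemma convex_LSplus P : convex P -> convex (LSplus P).
Proof.
move=> cvxP x y a /andP[a0 a1] [Y1 hY1 Y1x] [Y2 hY2 Y2y].
exists (a *: Y1 + (1 - a) *: Y2); first by apply: LSplus_hatD; rewrite ?subr_ge0.
rewrite mulmxDl -!scalemxAl Y1x Y2y !scale_col_mx add_col_mx; congr col_mx.
by rewrite -scalerDl addrC subrK scale1r.
Qed.

(** Ye_0 is the sum of Ye_i and Y(e_0 - e_i), both in the cone; [0 < n] supplies an index i. *)
Lemma LSplus_subset P : (0 < n)%N -> convex P -> LSplus P `<=` P.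
Proof.
move=> n0 cvxP x [Y [_ _ cY] Yx]; apply/cone1; rewrite -Yx.
have [c c'] := cY (Ordinal n0).
by have := convex_coneD cvxP c c'; rewrite -mulmxDr addrC subrK.
Qed.

(** The certificate is the rank one matrix [u *m u^T] with u = (1, x). As the entries of [u] are 0
    or 1, its diagonal is [u] and the vectors Ye_i and Y(e_0 - e_i) are 0 or [u]. *)
Lemma LSplus_incidence P (S : {set 'I_n}) :
  P (incidence R S) -> LSplus P (incidence R S).
Proof.
set x := incidence R S => Px; pose u : 'cV[R]_(1 + n) := col_mx 1%:M x.
have uE i : (u^T *m e_ R i) 0 0 = (i \in S)%:R.
  by rewrite -colE !mxE (unsplitK (inr _)) mxE.
have u0 : u^T *m e0 R n = 1%:M.
  by rewrite -colE; apply/rowP => i; rewrite [i]ord1 !mxE (unsplitK (inl _)) mxE.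
have uu i : u i 0 * u i 0 = u i 0.
  rewrite !mxE; case: splitP => j _; rewrite mxE ?[j]ord1 ?mulr1 //.
  by case: (j \in S); rewrite ?mulr1 ?mulr0.
have scal (c : 'M[R]_1) : u *m c = c 0 0 *: u.
  by rewrite [c in LHS]mx11_scalar mul_mx_scalar.
have cu (b : R) : 0 <= b -> cone P (b *: u).
  by move=> b0; apply: cone_scale => //; apply/cone1.
exists (u *m u^T); last by rewrite -mulmxA u0 mulmx1.
split=> [||i]; [split=> [|z]| |].
- by rewrite trmx_mul trmxK.
- rewrite mulmxA -mulmxA mxE big_ord1.
  have -> : (z^T *m u) 0 0 = (u^T *m z) 0 0.
    by rewrite !mxE; apply: eq_bigr => i _; rewrite !mxE mulrC.
  by rewrite -expr2 sqr_ge0.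
- rewrite -mulmxA u0 mulmx1; apply/colP => i.
  by rewrite [RHS]mxE [RHS]mxE big_ord1 [u^T _ _]mxE uu.
- split; rewrite -mulmxA scal; apply: cu; rewrite ?mulmxBr ?u0.
    by rewrite uE ler0n.
  by rewrite [_ 0 0]mxE [X in _ + X]mxE uE mxE; case: (i \in S); rewrite ?subrr ?subr0.
Qed.

Lemma convex_FRAC G : convex (FRAC G : set 'cV[R]_n).
Proof.
move=> x y a /andP[a0 a1] [x01 xE] [y01 yE]; split=> [i|i j Gij]; rewrite !mxE.
  by have /andP[] := x01 i; have /andP[] := y01 i; move=> *; apply/andP; split; nra.
by have := xE _ _ Gij; have := yE _ _ Gij; nra.
Qed.

Lemma FRAC_incidence G (S : {set 'I_n}) : stable G S -> FRAC G (incidence R S).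
Proof.
move=> stS; split=> [i|i j Gij]; rewrite !mxE; first by case: (i \in S); rewrite /= ?ler01 ?lexx.
have := stS i j; rewrite Gij.
by case: (i \in S); case: (j \in S) => [H|_] /=; try lra; have := H isT isT.
Qed.

Lemma convex_LSplus_iter G k : convex (LSplus_iter k G : set 'cV[R]_n).
Proof. by elim: k => [|k IH]; [apply: convex_FRAC | apply: convex_LSplus]. Qed.

Lemma LSplus_iter_incidence G k (S : {set 'I_n}) :
  stable G S -> LSplus_iter k G (incidence R S).
Proof.
by move=> stS; elim: k => [|k IH]; [apply: FRAC_incidence | apply: LSplus_incidence].
Qed.

Lemma STAB_sub_LSplus_iter G k : STAB (R := R) G `<=` LSplus_iter k G.
Proof.
apply: convex_hull_sub; first exact: convex_LSplus_iter.
by move=> _ [S stS ->]; apply: LSplus_iter_incidence.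
Qed.

Lemma LSplus_iter_subset G k l : (0 < n)%N -> (k <= l)%N ->
  LSplus_iter (R := R) l G `<=` LSplus_iter k G.
Proof.
move=> n0 /subnK <-; elim: (l - k)%N => // m IH x.
by move=> /(LSplus_subset n0 (@convex_LSplus_iter G _)) /IH.
Qed.

Lemma LSplus_iter_FRAC G k : (0 < n)%N -> LSplus_iter (R := R) k G `<=` FRAC G.
Proof. by move=> n0; apply: (@LSplus_iter_subset G 0 k). Qed.

Lemma stable0 G : stable G finset.set0.
Proof. by move=> i j; rewrite inE. Qed.

Lemma stable_sub G (S T : {set 'I_n}) : S \subset T -> stable G T -> stable G S.
Proof. by move=> /fintype.subsetP ST stT i j /ST iT /ST jT; apply: stT. Qed.

Lemma stable_setU1 G i (S : {set 'I_n}) :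
  stable G S -> (forall j, j \in S -> ~~ G i j) -> stable G (i |: S)%SET.
Proof.
move=> stS iS j k; rewrite !inE => /predU1P[->|jS] /predU1P[->|kS].
- by rewrite adj_irrefl.
- exact: iS.
- by rewrite adj_sym; apply: iS.
- exact: stS.
Qed.

(** * Valid inequalities of the stable set polytope *)

Definition valid G (a : 'I_n -> R) (b : R) :=
  forall S : {set 'I_n}, stable G S -> \sum_(i in S) a i <= b.

Lemma valid_ge0 G a b : valid G a b -> 0 <= b.
Proof. by move=> /(_ finset.set0 (@stable0 G)); rewrite big_set0. Qed.

Lemma valid_coef G a b i : valid G a b -> a i <= b.
Proof.
move=> /(_ [set i]%SET); rewrite big_set1; apply.
by move=> j k /set1P-> /set1P->; rewrite adj_irrefl.
Qed.

(** Deleting from a stable set the closed neighbourhood of [i] and then adding [i] leaves it stable;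
    the modified weights count exactly the vertices that were kept. *)
Lemma valid_link G a b i : valid G a b ->
  valid G (fun j => if (j == i) || G i j then 0 else a j) (b - a i).
Proof.
move=> va S stS; pose T := [set j in S | ~~ ((j == i) || G i j)]%SET.
rewrite lerBrDl (bigID (mem T)) /= [X in _ + (_ + X)]big1; last first.
  by move=> j; rewrite !inE => /andP[-> /=]; rewrite negbK => ->.
rewrite addr0; have stT : stable G (i |: T)%SET.
  apply: stable_setU1 => [|j]; last by rewrite !inE negb_or => /and3P[].
  by apply: stable_sub stS; apply/fintype.subsetP => j; rewrite !inE => /andP[].
apply: le_trans (va _ stT); rewrite big_setU1 ?inE ?eqxx ?andbF //= lerD2l.
rewrite le_eqVlt; apply/orP; left; apply/eqP.
rewrite [LHS](eq_bigl (mem T)); last by move=> j; rewrite /= !inE; case: (j \in S).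
by apply: eq_bigr => j; rewrite !inE => /andP[_ /negPf ->].
Qed.

(* If v has at most one neighbour in the support S, the inequality splits off
   a multiple of an edge (or bound) inequality of FRAC at v. *)
Lemma valid_leaf G a b (S : {set 'I_n}) v u x :
  valid G a b -> (forall i, 0 <= a i) -> (forall i, i \notin S -> a i = 0) ->
  (forall i, i \in S -> G v i -> i = u) -> FRAC G x -> G v u ->
  let a' i := if i == v then 0 else if i == u then Num.max (a u - a v) 0 else a i in
  valid G a' (b - a v) /\
  \sum_i a i * x i 0 <= \sum_i a' i * x i 0 + a v.
Proof.
move=> va a0 aS Nv [x01 xE] Gvu a'.
have uv : u != v by apply: contraTneq Gvu => ->; rewrite adj_irrefl.
have a'0 i : 0 <= a' i.
  by rewrite /a'; case: ifP => // _; case: ifP => // _; rewrite le_max lexx orbT.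
split; last first.
  have x0 i : 0 <= x i 0 by have /andP[] := x01 i.
  rewrite (bigD1 v) //= (bigD1 u) //= [X in _ <= X + _](bigD1 v) //=.
  rewrite [X in _ <= _ + X + _](bigD1 u) //= /a' !eqxx (negPf uv) mul0r add0r.
  rewrite [X in _ <= _ + X + _](eq_bigr (fun i => a i * x i 0)); last first.
    by move=> i /andP[/negPf -> /negPf ->].
  set s := \sum_(i < n | _) _.
  (* The difference is covered by [a v] times the edge inequality; where the maximum is 0, [a u] is
     first raised to [a v]. *)
  have := xE _ _ Gvu; have := x0 u; have := x0 v; have := a0 v; have := a0 u.
  by case: (lerP (a u - a v) 0) => h *; nra.
(* If [u] is in [T] and keeps the coefficient [a u - a v], then [v] is not in [T] and the inequality
   for [T] itself suffices. Otherwise [u] carries no weight in [T] and can be exchanged for [v]. *)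
move=> T stT; have [/andP[uT avu]|H] := boolP ((u \in T) && (a v <= a u)).
  have vT : v \notin T.
    by apply: contraL Gvu => vT; apply: stT.
  have := va _ stT; rewrite (bigD1 u) //= [X in _ -> X <= _](bigD1 u) //=.
  rewrite /a' eqxx (negPf uv) [X in _ -> _ + X <= _](eq_bigr a) => [|i /andP[iT /negPf->]].
    by rewrite max_l ?subr_ge0 // => ?; lra.
  by case: eqP iT vT => // -> ->.
have {}H : u \in T -> a' u = 0.
  move=> uT; move: H; rewrite uT /= -ltNge => H.
  by rewrite /a' (negPf uv) eqxx max_r // subr_le0 ltW.
(* The only neighbour of [v] in [S] is [u], so the rest of [T] within [S] can be extended by [v];
   vertices off [S] have weight 0. *)
pose T' := [set i in T | [&& i \in S, i != v & i != u]]%SET.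
have stT' : stable G (v |: T')%SET.
  apply: stable_setU1 => [|i].
    by apply: stable_sub stT; apply/fintype.subsetP => i; rewrite !inE => /andP[].
  rewrite !inE => /and4P[_ iS _ iu]; apply: contraNN iu => Gvi.
  by rewrite (Nv i).
have := va _ stT'; rewrite big_setU1 ?inE ?eqxx ?andbF //= => h.
suff : \sum_(i in T) a' i <= \sum_(i in T') a i by lra.
rewrite (bigID (mem T')) /= [X in _ + X]big1 ?addr0; last first.
  move=> i /andP[iT]; have [iu|iu] := eqVneq i u; first by rewrite iu H // -iu.
  rewrite !inE iT iu /= andbT negb_and negbK /a' (negPf iu).
  by case: eqP => // _; rewrite orbF => /aS.
rewrite [X in X <= _](eq_bigl (mem T')); last first.
  by move=> i; rewrite /= !inE; case: (i \in T).
by apply: ler_sum => i; rewrite !inE /a' => /and4P[_ _ /negPf-> /negPf->].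
Qed.

End LSplusTheory.

(** * Upper bound on the LS_+-rank *)

Section UpperBound.
Variables (R : realType) (n : nat) (G : sgraph n).
Implicit Types (P : set 'cV[R]_n) (S : {set 'I_n}) (a : 'I_n -> R) (b : R).

(** Inequalities supported in [S] stand for the subgraph induced by [S], so vertices can be deleted
    while [G] stays fixed. *)
Definition satisfies_valid P S :=
  forall a b x, (forall i, 0 <= a i) -> (forall i, i \notin S -> a i = 0) ->
  valid G a b -> P x -> \sum_i a i * x i 0 <= b.

Lemma satisfies_valid_leaf P S v :
  P `<=` FRAC G -> v \in S -> (#|[set u in S | G v u]%SET| <= 1)%N ->
  satisfies_valid P (S :\ v)%SET -> satisfies_valid P S.
Proof.
move=> PF vS /card_le1_eqP Nv IH a b x a0 aS va Px.
have [u /andP[uS Gvu]|noN] := pickP (fun u => (u \in S) && G v u).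
  have Nu i : i \in S -> G v i -> i = u.
    by move=> iS Gvi; apply: Nv; rewrite inE ?iS ?uS.
  have [va' le_a'] := valid_leaf va a0 aS Nu (PF _ Px) Gvu.
  apply: le_trans le_a' _; rewrite -lerBrDr; apply: IH va' Px => i.
    by case: ifP => // _; case: ifP => // _; rewrite le_max lexx orbT.
  rewrite !inE negb_and negbK; case: eqP => //= _ iS.
  by case: eqP => [iu|_]; [rewrite -iu (negPf iS) in uS | apply: aS].
(* Without neighbours in [S], the vertex [v] is split off with the bound x_v <= 1: passing to the
   link of [v] drops no weight other than [a v]. *)
have := valid_link v va; set a' := fun _ => _ => va'.
rewrite (bigD1 v) //= addrC -lerBrDr.
have [/(_ v)/andP[xv0 xv1] _] := PF _ Px.
apply: (@le_trans _ _ (b - a v)); last by have := a0 v; nra.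
suff -> : \sum_(i < n | i != v) a i * x i 0 = \sum_i a' i * x i 0.
  apply: IH va' Px => i; first by rewrite /a'; case: ifP.
  by rewrite !inE /a'; case: eqP => //= _ /aS ->; rewrite if_same.
rewrite [RHS](bigD1 v) //= /a' eqxx mul0r add0r; apply: eq_bigr => i iv.
rewrite (negPf iv) /=; case: ifP => // Gvi.
by rewrite aS //; have := noN i; rewrite Gvi andbT => ->.
Qed.

(** Peeling off vertices with at most one neighbour in the current set ends in a set where every
    vertex has at least two. *)
Lemma satisfies_valid_min_degree P N :
  P `<=` FRAC G ->
  (forall S, (#|S| <= N)%N ->
    (forall v, v \in S -> (1 < #|[set u in S | G v u]%SET|)%N) ->
    satisfies_valid P S) ->
  forall S, (#|S| <= N)%N -> satisfies_valid P S.
Proof.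
move=> PF core S SN; have [m] := ubnP #|S|; elim: m S SN => // m IH S SN Sm.
have [v /andP[vS dv]|no] := pickP (fun v => (v \in S) && (#|[set u in S | G v u]%SET| <= 1)%N).
  by apply: satisfies_valid_leaf dv _ => //; apply: IH; move: SN Sm; rewrite (cardsD1 v S) vS; lia.
by apply: core => // v vS; have := no v; rewrite vS ltnNge /= => ->.
Qed.

Lemma satisfies_valid_LSplus P S :
  P `<=` FRAC G ->
  (forall i, i \in S -> satisfies_valid P [set j in S | ~~ ((j == i) || G i j)]%SET) ->
  satisfies_valid (LSplus P) S.
Proof.
move=> PF IH a b x a0 aS va [Y [[symY psdY] dY cY] Yx].
have Y0 i : Y (rshift 1 i) (lshift n 0) = x i 0.
  by have /colP/(_ (rshift 1 i)) := Yx; rewrite -colE mxE col_mxEd.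
have Yii i : Y (rshift 1 i) (rshift 1 i) = x i 0.
  by have /colP/(_ (rshift 1 i)) := dY; rewrite Yx col_mxEd mxE.
have sY i j : Y i j = Y j i by rewrite -[in LHS]symY mxE.
have Y0' i : Y (lshift n 0) (rshift 1 i) = x i 0 by rewrite sY Y0.
have Y00 : Y (lshift n 0) (lshift n 0) = 1.
  by have /colP/(_ (lshift n 0)) := Yx; rewrite -colE mxE col_mxEu mxE.
pose t := \sum_i a i * x i 0.
have col_le i : i \in S -> \sum_j a j * Y (rshift 1 i) (rshift 1 j) <= b * x i 0.
  move=> iS; have [[c [z [c0 Pz /colP colY]]] _] := cY i.
  have YE j : Y (rshift 1 i) (rshift 1 j) = c * z j 0.
    by rewrite sY; have := colY (rshift 1 j); rewrite -colE mxE col_mxEd mxE.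
  have cE : x i 0 = c.
    by have := colY (lshift n 0); rewrite -colE mxE col_mxEu mxE mulr1n Y0'.
  rewrite cE; under eq_bigr do rewrite YE mulrCA.
  rewrite -mulr_sumr mulrC; have [->|cN0] := eqVneq c 0; first by rewrite !mulr0.
  rewrite ler_wpM2r //.
  (* Since the diagonal of [Y] is its first column, the normalized column has [z i 0 = 1]. The edge
     inequalities then make [z] vanish at the neighbours of [i], and what remains is the inequality
     of the link of [i]. *)
  have zi : z i 0 = 1 by apply: (mulfI cN0); rewrite mulr1 -YE Yii.
  have [z01 zE] := PF _ Pz.
  have := valid_link i va; set a' := fun _ => _ => va'.
  have : \sum_j a' j * z j 0 <= b - a i.
    apply: (IH i iS a') => // j; first by rewrite /a'; case: ifP.
    by rewrite !inE negb_and negbK /a'; case: ifP => //= _ /orP[/aS|].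
  suff -> : \sum_j a j * z j 0 = \sum_j a' j * z j 0 + a i by lra.
  rewrite (bigD1 i) //= zi mulr1 addrC [in RHS](bigD1 i) //= {1}/a' eqxx mul0r add0r.
  congr (_ + _); apply: eq_bigr => j ji; rewrite /a' (negPf ji) /=.
  case: ifP => // Gij; have /andP[zj0 _] := z01 j; have := zE _ _ Gij; rewrite zi => zj.
  have -> : z j 0 = 0 by lra.
  by rewrite !mulr0.
have quad : \sum_i a i * (\sum_j a j * Y (rshift 1 i) (rshift 1 j)) <= b * t.
  rewrite mulr_sumr ler_sum // => i _; have [iS|iS] := boolP (i \in S).
    by rewrite mulrCA ler_wpM2l // col_le.
  by rewrite aS // !mul0r mulr0.
(* Positive semidefiniteness at (b, -a) reads b^2 - 2bt + q >= 0, where q is the sum bounded by bt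
   in [quad]; hence b(b - t) >= 0. *)
pose z : 'cV[R]_(1 + n) := col_mx b%:M (- \col_i a i).
have Yz p : (Y *m z) p 0 = b * Y p (lshift n 0) - \sum_j a j * Y p (rshift 1 j).
  rewrite mxE big_split_ord big_ord1 /= col_mxEu mxE mulr1n mulrC -sumrN; congr (_ + _).
  by apply: eq_bigr => j _; rewrite col_mxEd !mxE mulrN mulrC.
have z0 : z^T 0 (lshift n 0) = b by rewrite mxE col_mxEu mxE mulr1n.
have zr j : z^T 0 (rshift 1 j) = - a j by rewrite mxE col_mxEd !mxE.
have := psdY z; rewrite -mulmxA mxE big_split_ord big_ord1 /= z0.
under eq_bigr do rewrite zr Yz Y0 mulNr mulrBr mulrCA opprB.
rewrite Yz Y00 mulr1 big_split /= sumrN -mulr_sumr -/t.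
under [X in _ - X]eq_bigr do rewrite Y0'.
rewrite -/t => psdz; have b0 := valid_ge0 va.
have bt : 0 <= b * (b - t) by move: quad psdz; set q := \sum_i _; nra.
(* For [b = 0] this gives no information, but validity then forces [a] to vanish. *)
have [b0'|bN0] := eqVneq b 0; last first.
  by rewrite -subr_ge0 -(pmulr_rge0 _ (_ : 0 < b)) // lt_neqAle eq_sym bN0.
rewrite b0' /t big1 // => i _.
suff -> : a i = 0 by rewrite mul0r.
by apply/eqP; rewrite eq_le a0 andbT -b0'; apply: valid_coef va.
Qed.

(** Once every vertex of [S] has two neighbours in [S], deleting a closed neighbourhood removes at
    least three vertices, so the bound for [k.+1] drops to the one for [k]. At level 0 peeling
    leaves the empty set, as degree two needs three vertices. *)
Lemma LSplus_iter_satisfies_valid k S :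
  (#|S| <= 3 * k + 2)%N -> satisfies_valid (LSplus_iter k G) S.
Proof.
have [->|[v vS]] := set_0Vmem S.
  move=> _ a b x a0 aS va _; rewrite big1 ?(valid_ge0 va) // => i _.
  by rewrite aS ?inE ?mul0r.
have n0 : (0 < n)%N by apply: leq_ltn_trans (ltn_ord v).
elim: k S {v vS} => [|k IH] S; apply: satisfies_valid_min_degree S.
- by [].
- move=> S S2 dS; have [->|[v vS]] := set_0Vmem S.
    move=> a b x a0 aS va _; rewrite big1 ?(valid_ge0 va) // => i _.
    by rewrite aS ?inE ?mul0r.
  have := dS v vS; suff : (#|[set u in S | G v u]%SET| <= #|S :\ v|%SET)%N.
    by move: S2; rewrite (cardsD1 v S) vS; lia.
  apply/subset_leq_card/fintype.subsetP => u; rewrite !inE => /andP[-> Gvu].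
  by rewrite andbT; apply: contraTneq Gvu => ->; rewrite adj_irrefl.
- exact: LSplus_iter_FRAC.
move=> S Sk dS; apply: satisfies_valid_LSplus; first exact: LSplus_iter_FRAC.
move=> v vS; apply: IH.
have := dS v vS; have := cardsID [set u | (u == v) || G v u]%SET S.
have -> : (S :\: [set u | (u == v) || G v u] = [set j in S | ~~ ((j == v) || G v j)])%SET.
  by apply/setP => j; rewrite !inE andbC.
have -> : (S :&: [set u | (u == v) || G v u] = v |: [set u in S | G v u])%SET.
  by apply/setP => j; rewrite !inE; case: eqP => [->|//]; rewrite vS.
rewrite cardsU1 !inE adj_irrefl andbF /=; move: Sk.
by move: #|S| #|[set u in S | G v u]%SET| #|[set j in S | _]%SET| => p q r; lia.
Qed.

(** Farkas' lemma is applied to the incidence vectors of stable sets with a leading 1. Negative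
    coefficients of a separating inequality are replaced by 0: it stays valid because subsets of
    stable sets are stable, and its left side at [x >= 0] does not decrease. *)
Lemma STAB_separation (x : 'cV[R]_n) :
  (forall i, 0 <= x i 0) ->
  (forall a b, (forall i, 0 <= a i) -> valid G a b -> \sum_i a i * x i 0 <= b) ->
  STAB G x.
Proof.
move=> x0 xv; apply/cone1.
pose us := [seq col_mx 1%:M (incidence R T) | T : {set 'I_n} <- enum {set 'I_n}
                                            & `[< stable G T >]].
have cvx : convex (STAB G : set 'cV[R]_n) := @convex_hull_convex _ _ _.
have st1 S : stable G S -> STAB G (incidence R S).
  by move=> stS; apply: convex_hull_incl; exists S.
suff comb : conic_comb us (col_mx 1%:M x).
  have : forall u, u \in us -> cone (STAB G) u.
    by move=> u /mapP[S]; rewrite mem_filter => /andP[/asboolP stS _] ->; apply/cone1/st1.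
  elim: us (col_mx _ _) comb => [|u us IH] b /= => [->|[c c0 comb]] usC.
    exact: cone0 (st1 _ (@stable0 _ G)).
  rewrite -(subrK (c *: u) b); apply: convex_coneD => //.
    by apply: IH comb _ => v vus; apply: usC; rewrite inE vus orbT.
  by apply: cone_scale => //; apply: usC; rewrite inE eqxx.
have dotE (y : 'cV[R]_(1 + n)) (w : 'cV[R]_n) : (y^T *m col_mx 1%:M w) 0 0 =
    y (lshift n 0) 0 + \sum_i y (rshift 1 i) 0 * w i 0.
  rewrite mxE big_split_ord big_ord1 /= col_mxEu !mxE mulr1; congr (_ + _).
  by apply: eq_bigr => i _; rewrite col_mxEd !mxE.
apply: farkas => y yus; rewrite dotE.
pose a i := Num.max (y (rshift 1 i) 0) 0.
have ya : \sum_i y (rshift 1 i) 0 * x i 0 <= \sum_i a i * x i 0.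
  by apply: ler_sum => i _; rewrite ler_wpM2r // le_max lexx.
suff : \sum_i a i * x i 0 <= - y (lshift n 0) 0 by lra.
apply: xv => [i|S stS]; first by rewrite le_max lexx orbT.
pose T := [set i in S | 0 <= y (rshift 1 i) 0]%SET.
have stT : stable G T.
  by apply: stable_sub stS; apply/fintype.subsetP => i; rewrite inE => /andP[].
have Tus : col_mx 1%:M (incidence R T) \in us.
  by apply/mapP; exists T => //; rewrite mem_filter mem_enum inE andbT; apply/asboolP.
have := yus _ Tus; rewrite dotE.
suff -> : \sum_(i in S) a i = \sum_i y (rshift 1 i) 0 * incidence R T i 0.
  by move=> ?; lra.
rewrite big_mkcond; apply: eq_bigr => i _; rewrite mxE inE /a.
by case: ifP => _ /=; rewrite ?mulr0 //; case: leP => /= ?; rewrite ?mulr0 ?mulr1.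
Qed.

Theorem LSplus_iter_STAB k : (n <= 3 * k + 2)%N -> LSplus_iter k G = STAB (R := R) G.
Proof.
move=> nk; apply/seteqP; split; last exact: STAB_sub_LSplus_iter.
move=> x xk; apply: STAB_separation => [i|a b a0 va].
  have n0 : (0 < n)%N by apply: leq_ltn_trans (ltn_ord i).
  by have [/(_ i)/andP[]] := LSplus_iter_FRAC n0 xk.
apply: (@LSplus_iter_satisfies_valid k [set: 'I_n]%SET) va xk => //.
  by rewrite cardsT card_ord.
by move=> i; rewrite inE.
Qed.

End UpperBound.

(** * Endomorphisms and integer quadratic forms *)

Delimit Scope Z_scope with BZ.

Section Endomorphism.
Variables (R : realType) (n : nat) (s : 'I_n -> 'I_n).

Definition pull (x : 'cV[R]_n) : 'cV[R]_n := \col_i x (s i) 0.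

(** The map [s] on homogenized indices, fixing index 0. *)
Let s1 (i : 'I_(1 + n)) : 'I_(1 + n) :=
  match split i with inl _ => lshift n 0 | inr j => rshift 1 (s j) end.

Let s1l i : s1 (lshift n i) = lshift n 0.
Proof. by rewrite /s1 (unsplitK (inl _)). Qed.

Let s1r i : s1 (rshift 1 i) = rshift 1 (s i).
Proof. by rewrite /s1 (unsplitK (inr _)). Qed.

Lemma cone_pull (P : set 'cV[R]_n) (u : 'cV[R]_(1 + n)) :
  (forall x, P x -> P (pull x)) -> cone P u ->
  cone P (col_mx (usubmx u) (pull (dsubmx u))).
Proof.
move=> PP [a [x [a0 Px ->]]]; exists a, (pull x); split=> //; first exact: PP.
by rewrite col_mxKu col_mxKd; congr col_mx; apply/colP => i; rewrite !mxE.
Qed.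

Let rowsub_s1 (u : 'cV[R]_(1 + n)) : rowsub s1 u = col_mx (usubmx u) (pull (dsubmx u)).
Proof.
apply/colP => i; rewrite mxE; case: (split_ordP i) => j ->.
  by rewrite s1l col_mxEu mxE [j]ord1.
by rewrite s1r col_mxEd !mxE.
Qed.

(** The certificate becomes [A *m Y *m A^T], where [A] selects coordinates along [s1]. As [A^T]
    sends e_i to e_(s i), the new columns are the pulled back columns of [Y] at [s i]. *)
Lemma LSplus_pull (P : set 'cV[R]_n) x :
  (forall x, P x -> P (pull x)) -> LSplus P x -> LSplus P (pull x).
Proof.
move=> PP [Y [[symY psdY] dY cY] Yx].
pose A : 'M[R]_(1 + n) := rowsub s1 1%:M.
have AE (u : 'cV[R]_(1 + n)) : A *m u = rowsub s1 u by rewrite -rowsubE.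
have Ae i : A^T *m delta_mx i 0 = delta_mx (s1 i) 0 :> 'cV[R]_(1 + n).
  by rewrite -colE; apply/colP => j; rewrite !mxE eqxx andbT eq_sym.
have Ae0 : A^T *m e0 R n = e0 R n by rewrite Ae s1l.
have Aei i : A^T *m e_ R i = e_ R (s i) by rewrite Ae s1r.
have Au (u : 'cV[R]_(1 + n)) : cone P u -> cone P (A *m u).
  by move=> Cu; rewrite AE rowsub_s1; apply: cone_pull.
have YA (u : 'cV[R]_(1 + n)) : A *m Y *m A^T *m u = A *m (Y *m (A^T *m u)).
  by rewrite -!mulmxA.
exists (A *m Y *m A^T); last first.
  by rewrite YA Ae0 Yx AE rowsub_s1 col_mxKu col_mxKd.
split=> [||i]; [split=> [|z]| |].
- by rewrite !trmx_mul trmxK symY mulmxA.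
- have := psdY (A^T *m z); rewrite trmx_mul trmxK.
  by rewrite -!mulmxA.
- rewrite YA Ae0 dY AE; apply/colP => i; rewrite mxE mxE [RHS]mxE.
  have /colP/(_ i) := YA (delta_mx i 0); rewrite Ae AE -!colE.
  by rewrite [LHS]mxE [RHS]mxE [RHS]mxE.
- by have [c c'] := cY (s i); rewrite !YA mulmxBr Ae0 Aei; split; apply: Au.
Qed.

Lemma LSplus_iter_pull (G : sgraph n) k x :
  (forall i j, G i j -> G (s i) (s j)) ->
  LSplus_iter k G x -> LSplus_iter k G (pull x).
Proof.
move=> sG; elim: k x => [x [x01 xE]|k IH x]; last exact: LSplus_pull.
by split=> [i|i j /sG Gij]; rewrite !mxE; [apply: x01 | apply: xE].
Qed.

End Endomorphism.

(** * Semidefiniteness of integer matrices *)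

Section IntegerForms.
Variable R : realType.

Definition zr (z : Z) : R := (int_of_Z z)%:~R.

Lemma zrD x y : zr (x + y)%BZ = zr x + zr y.
Proof. by rewrite /zr -intrD; congr _%:~R; lia. Qed.
Lemma zrB x y : zr (x - y)%BZ = zr x - zr y.
Proof. by rewrite /zr -intrB; congr _%:~R; lia. Qed.
Lemma zrM x y : zr (x * y)%BZ = zr x * zr y.
Proof. by rewrite /zr -intrM; congr _%:~R; lia. Qed.
Lemma zr0 : zr 0 = 0. Proof. by []. Qed.
Lemma zr_ge0 x : (0 <=? x)%BZ -> 0 <= zr x.
Proof. by move=> x0; rewrite /zr ler0z; lia. Qed.
Lemma zr_gt0 x : (0 <? x)%BZ -> 0 < zr x.
Proof. by move=> x0; rewrite /zr ltr0z; lia. Qed.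
Lemma zr_le x y : (x <=? y)%BZ -> zr x <= zr y.
Proof. by move=> xy; rewrite /zr ler_int; lia. Qed.
Lemma zr_lt x y : (x <? y)%BZ -> zr x < zr y.
Proof. by move=> xy; rewrite /zr ltr_int; lia. Qed.

(* A symmetric matrix is given by the rows of its upper triangle, each row
   starting at the diagonal. *)
Definition ent (M : seq (seq Z)) i j : Z :=
  nth 0%BZ (nth [::] M (minn i j)) (maxn i j - minn i j).

Fixpoint triangular m (M : seq (seq Z)) : bool :=
  match m, M with
  | 0, [::] => true
  | m'.+1, r :: M' => (size r == m) && triangular m' M'
  | _, _ => false
  end.

Fixpoint dotp (c : seq Z) (z : seq R) : R :=
  match c, z with x :: c', y :: z' => zr x * y + dotp c' z' | _, _ => 0 end.

Fixpoint qform (M : seq (seq Z)) (z : seq R) : R :=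
  match M, z with
  | (p :: c) :: M', y :: z' => zr p * y ^+ 2 + 2 * y * dotp c z' + qform M' z'
  | _, _ => 0
  end.

Lemma dotpE (c : seq Z) (f : nat -> R) :
  dotp c (mkseq f (size c)) = \sum_(i < size c) zr (nth 0%BZ c i) * f i.
Proof.
elim: c f => [|x c IH] f; first by rewrite big_ord0.
by rewrite big_ord_recl /= (iotaDl 1 0) -map_comp (IH (f \o S)).
Qed.

Lemma qformE m M (f : nat -> R) : triangular m M ->
  qform M (mkseq f m) = \sum_(i < m) \sum_(j < m) zr (ent M i j) * (f i * f j).
Proof.
elim: m M f => [|m IH] [|r M] f //=; first by rewrite big_ord0.
move=> /andP[/eqP sr trM]; case: r sr => //= p c [sc].
rewrite (iotaDl 1 0) -map_comp -/(mkseq (f \o S) m) IH // -{1}sc dotpE sc.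
rewrite big_ord_recl /= big_ord_recl /=.
under [X in _ = _ + X]eq_bigr do rewrite big_ord_recl /=.
rewrite big_split /=.
have E1 : \sum_(i < m) zr (ent ((p :: c) :: M) (bump 0 i) 0) * (f (bump 0 i) * f 0) =
          f 0 * \sum_(i < m) zr (nth 0%BZ c i) * (f \o S) i.
  by rewrite mulr_sumr; apply: eq_bigr => i _; rewrite /ent /= !mulrA; ring.
have E2 : \sum_(i < m) zr (ent ((p :: c) :: M) 0 (bump 0 i)) * (f 0 * f (bump 0 i)) =
          f 0 * \sum_(i < m) zr (nth 0%BZ c i) * (f \o S) i.
  by rewrite mulr_sumr; apply: eq_bigr => i _; rewrite /ent /= !mulrA; ring.
have E3 : \sum_(i < m) \sum_(j < m) zr (ent ((p :: c) :: M) (bump 0 i) (bump 0 j)) *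
            (f (bump 0 i) * f (bump 0 j)) =
          \sum_(i < m) \sum_(j < m) zr (ent M i j) * ((f \o S) i * (f \o S) j).
  apply: eq_bigr => i _; apply: eq_bigr => j _.
  by rewrite /ent minnSS maxnSS subSS.
by rewrite E1 E2 E3 /ent /=; ring.
Qed.

(** The upper triangle of p M - c c^T, which is [p] times the Schur complement of the pivot [p]. *)
Fixpoint schur (p : Z) (c : seq Z) (M : seq (seq Z)) : seq (seq Z) :=
  match c, M with
  | x :: c', r :: M' => [seq (p * e.1 - x * e.2)%BZ | e <- zip r c] :: schur p c' M'
  | _, _ => [::]
  end.

Lemma dotp_lin p x r c z : size r = size c ->
  dotp [seq (p * e.1 - x * e.2)%BZ | e <- zip r c] z = zr p * dotp r z - zr x * dotp c z.
Proof.
elim: r c z => [|y r IH] [|w c] [|t z] //= => [_|_|_|[/IH->]]; rewrite ?mulr0 ?subr0 //.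
by rewrite zrB !zrM; ring.
Qed.

Lemma qform_schur m p c M z : triangular m M -> size c = m -> size z = m ->
  qform (schur p c M) z = zr p * qform M z - dotp c z ^+ 2.
Proof.
elim: m c M z => [|m IH] [|x c] [|r M] // [|t z] //=; first by rewrite mulr0 expr0n subr0.
move=> /andP[/eqP sr trM] [sc] [sz]; case: r sr => //= y r [sr].
by rewrite IH // dotp_lin ?sr // zrB !zrM; ring.
Qed.

Lemma triangular_schur m p c M : triangular m M -> size c = m -> triangular m (schur p c M).
Proof.
elim: m c M => [|m IH] [|x c] [|r M] //= /andP[/eqP sr trM] [sc].
case: r sr => //= y r [sr].
by rewrite size_map size1_zip ?sr ?sc //= eqxx IH.
Qed.

Definition scaleZ (p : Z) (M : seq (seq Z)) := [seq [seq (p * x)%BZ | x <- r] | r <- M].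

Lemma qform_scale p M z : qform (scaleZ p M) z = zr p * qform M z.
Proof.
have dotp_scale c y : dotp [seq (p * x)%BZ | x <- c] y = zr p * dotp c y.
  elim: c y => [|x c IH] [|t y] /=; rewrite ?mulr0 //.
  by rewrite IH zrM; ring.
elim: M z => [|[|x r] M IH] [|t z] /=; rewrite ?mulr0 //.
by rewrite IH dotp_scale zrM; ring.
Qed.

(* Fraction-free (Bareiss) elimination: [prev] is the previous nonzero pivot,
   by which the Schur complement is exactly divisible. *)
Fixpoint psdb m (prev : Z) (M : seq (seq Z)) : bool :=
  match m, M with
  | m'.+1, (p :: c) :: M' =>
    if (p =? 0)%BZ then all (Z.eqb^~ 0%BZ) c && psdb m' prev M'
    else let U := schur p c M' in
         let Q := [seq [seq (x / prev)%BZ | x <- r] | r <- U] in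
         [&& (0 <? p)%BZ, U == scaleZ prev Q & psdb m' p Q]
  | 0, [::] => true
  | _, _ => false
  end.

(** For a positive pivot the square is completed: [p] times the form is [(zr p * y + dotp c z) ^+ 2]
    plus [prev] times the form of [Q]. Exactness of the division by [prev] is part of the test. A
    zero pivot is accepted only with a zero row. *)
Lemma psdb_sound m prev M z : (0 <? prev)%BZ -> triangular m M -> psdb m prev M ->
  size z = m -> 0 <= qform M z.
Proof.
elim: m prev M z => [|m IH] prev [|r M] [|y z] //= prev0 /andP[/eqP sr trM].
case: r sr => //= p c [sc]; case: Z.eqb_spec => [->|_].
  move=> /andP[c0 psdM] [sz]; rewrite zr0 mul0r add0r.
  have -> : dotp c z = 0.
    elim: c z c0 {sc psdM sz} => [|x c IHc] [|t z] //= /andP[/Z.eqb_spec -> /IHc->].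
    by rewrite zr0 mul0r addr0.
  by rewrite mulr0 add0r; apply: IH psdM sz.
set Q := [seq _ | _ <- _] => /and3P[p0 /eqP UQ psdQ] [sz].
have trQ : triangular m Q.
  have := triangular_schur p trM sc; rewrite /Q; move: (schur _ _ _) {sc trM psdQ IH UQ sz Q}.
  by elim: m => [|m IHm] [|r U] //= /andP[sr /IHm->]; rewrite size_map sr.
have q0 : 0 <= qform Q z by apply: IH psdQ sz.
have := qform_schur p trM sc sz; rewrite UQ qform_scale => E.
have pp := zr_gt0 p0; have pv := zr_gt0 prev0.
rewrite -(pmulr_rge0 _ pp).
have -> : zr p * (zr p * y ^+ 2 + 2 * y * dotp c z + qform M z) =
    (zr p * y + dotp c z) ^+ 2 + zr prev * qform Q z by rewrite E; ring.
by rewrite addr_ge0 ?sqr_ge0 // mulr_ge0 // ltW.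
Qed.

End IntegerForms.

(** * Integer certificates *)

Section Certificates.
Variables (R : realType) (n : nat) (G : sgraph n) (E : seq (nat * nat)).
Hypothesis GE : forall i j : 'I_n,
  G i j = ((i : nat, j : nat) \in E) || ((j : nat, i : nat) \in E).
Implicit Types (v w : seq Z) (M : seq (seq Z)) (P : set 'cV[R]_n).

Local Notation zr := (zr R).

(* Entry 0 of [v] is the homogenizing coordinate, entry i.+1 belongs to vertex i. *)
Definition vecR v : 'cV[R]_(1 + n) := \col_i zr (nth 0%BZ v i).

Lemma cone_vecR P v : (0 <? nth 0 v 0)%BZ ->
  P (\col_i (zr (nth 0%BZ v i.+1) / zr (nth 0%BZ v 0))) -> cone P (vecR v).
Proof.
move=> v0 Pv; have v0' := zr_gt0 R v0; eexists _, _; split; [exact: ltW v0' | exact: Pv |].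
apply/colP => i; rewrite mxE; case: (split_ordP i) => j ->.
  by rewrite col_mxEu mxE [j]ord1 mulr1n.
by rewrite col_mxEd !mxE /= mulrC divfK // gt_eqF.
Qed.

Definition fracb v : bool :=
  let v0 := nth 0%BZ v 0 in
  [&& (0 <=? v0)%BZ,
      all (fun i => (0 <=? nth 0 v i)%BZ && (nth 0 v i <=? v0)%BZ) (iota 1 n)
    & all (fun e => (nth 0 v e.1.+1 + nth 0 v e.2.+1 <=? v0)%BZ) E].

Lemma fracb_sound v : fracb v -> cone (FRAC G) (vecR v).
Proof.
move=> /and3P[v0 /allP vb /allP vE].
have vi (i : 'I_n) : 0 <= zr (nth 0%BZ v i.+1) <= zr (nth 0%BZ v 0).
  have /vb/andP[a b] : i.+1 \in iota 1 n by rewrite mem_iota /= add1n ltnS ltn_ord.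
  by rewrite zr_ge0 // zr_le.
(* If the homogenizing entry is 0, the bounds force the whole vector to be 0. *)
have [v00|vN0] := eqVneq (nth 0%BZ v 0) 0%BZ.
  suff -> : vecR v = 0.
    apply: (@cone0 _ _ _ 0); split=> [i|i j _]; rewrite !mxE ?lexx ?ler01 //.
    by rewrite addr0 ler01.
  apply/colP => i; rewrite !mxE; case: (split_ordP i) => j -> /=.
    by rewrite [j]ord1 /= v00.
  by have := vi j; rewrite v00 zr0 => /andP[a b]; apply/eqP; rewrite eq_le a b.
have v0' : (0 <? nth 0 v 0)%BZ by move: v0 vN0 => v0 /eqP; move: (nth _ _ _) v0 => z; lia.
have pv := zr_gt0 R v0'.
apply: cone_vecR => //; split=> [i|i j]; rewrite !mxE.
  have /andP[a b] := vi i; rewrite divr_ge0 ?(ltW pv) //=.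
  by rewrite ler_pdivrMr // mul1r.
rewrite -mulrDl ler_pdivrMr // mul1r -zrD GE => /orP[/vE|/vE] /= h; apply: zr_le => //.
by rewrite Z.add_comm.
Qed.

(** Entry 0 collects the total weight and needs its own test, because [i.-1] is 0 there as well as
    for vertex 0. *)
Definition stab_vec (l : seq (Z * seq nat)) : seq Z :=
  mkseq (fun i => foldr (fun wS t =>
    ((if (i == 0%N) || (i.-1 \in wS.2) then wS.1 else 0) + t)%BZ) 0%BZ l) n.+1.

Definition stableb (S : seq nat) := all (fun e => ~~ ((e.1 \in S) && (e.2 \in S))) E.

Definition stabb (l : seq (Z * seq nat)) : bool :=
  all (fun wS => (0 <=? wS.1)%BZ && stableb wS.2) l.

Lemma stabb_sound l : stabb l -> cone (STAB G) (vecR (stab_vec l)).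
Proof.
have st1 S : stable G S -> STAB G (incidence R S).
  by move=> stS; apply: convex_hull_incl; exists S.
elim: l => [_|[w S] l IH /= /andP[/andP[w0 /= stS] /IH {}IH]].
  suff -> : vecR (stab_vec [::]) = 0 by apply: cone0 (st1 _ (@stable0 _ G)).
  by apply/colP => i; rewrite !mxE nth_mkseq.
pose T := [set i : 'I_n | (i : nat) \in S]%SET.
have stT : stable G T.
  move=> i j; rewrite !inE => iS jS; rewrite GE; apply/negP.
  by case/orP => /(allP stS) /=; rewrite iS jS.
have -> : vecR (stab_vec ((w, S) :: l)) =
    zr w *: col_mx 1%:M (incidence R T) + vecR (stab_vec l).
  apply/colP => i; rewrite mxE [RHS]mxE [X in _ = X + _]mxE [X in _ = _ + X]mxE.
  rewrite !nth_mkseq // zrD; congr (_ + _); case: (split_ordP i) => j ->.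
    by rewrite col_mxEu mxE [j]ord1 /= mulr1.
  by rewrite col_mxEd mxE inE /=; case: ifP; rewrite ?mulr1 ?mulr0.
apply: convex_coneD => //; first exact: convex_hull_convex.
by apply: cone_scale; [apply: zr_ge0 | apply/cone1/st1].
Qed.

Definition pullv (s : seq nat) v : seq Z :=
  mkseq (fun i => nth 0%BZ v (if i is j.+1 then (nth 0%N s j).+1 else 0%N)) n.+1.

Definition homb (s : seq nat) : bool :=
  all (fun i => nth 0%N s i < n)%N (iota 0 n) &&
  all (fun e => let i := nth 0%N s e.1 in let j := nth 0%N s e.2 in
                ((i, j) \in E) || ((j, i) \in E)) E.

Lemma homb_sound k s v : homb s -> cone (LSplus_iter k G) (vecR v) ->
  cone (LSplus_iter k G) (vecR (pullv s v)).
Proof.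
(* The default [i] of [insubd] is never taken, since [homb] keeps the images below [n]. *)
move=> /andP[/allP sn /allP sE]; pose f (i : 'I_n) : 'I_n := insubd i (nth 0%N s i).
have fE i : f i = nth 0%N s i :> nat.
  by rewrite val_insubd sn // mem_iota add0n ltn_ord.
have fG i j : G i j -> G (f i) (f j).
  by rewrite !GE !fE => /orP[/sE|/sE] //=; rewrite orbC.
move=> /(cone_pull (fun x => @LSplus_iter_pull _ _ f G k x fG)).
suff -> : vecR (pullv s v) = col_mx (usubmx (vecR v)) (pull f (dsubmx (vecR v))) by [].
apply/colP => i; case: (split_ordP i) => j ->.
  by rewrite col_mxEu !mxE nth_mkseq //= [j]ord1.
by rewrite col_mxEd !mxE nth_mkseq // [in LHS]/= -fE.
Qed.

Definition matchb (ss : seq (seq nat)) (C : seq (seq Z)) v : bool :=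
  has (fun w => has (fun s => v == pullv s w) ss) C.

Lemma matchb_sound k ss C v : all homb ss ->
  (forall w, w \in C -> cone (LSplus_iter k G) (vecR w)) ->
  matchb ss C v -> cone (LSplus_iter k G) (vecR v).
Proof.
move=> /allP hom CP /hasP[w wC /hasP[s sss /eqP ->]].
by apply: homb_sound; [apply: hom | apply: CP].
Qed.

(** [col_of] and [cocol_of] are the vectors Ye_i and Y(e_0 - e_i) from the definition of LS_+. *)
Definition col_of M i : seq Z := mkseq (ent M i) n.+1.
Definition cocol_of M i : seq Z := mkseq (fun j => (ent M 0 j - ent M i j)%BZ) n.+1.

(* When row i vanishes or equals row 0, a column is equal to column 0, which
   lies in the cone by convexity as soon as one pair of columns does. *)
Definition lsb (colok : seq Z -> bool) M : bool :=
  let c0 := col_of M 0 in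
  let ok v := colok v || (v == c0) in
  [&& triangular n.+1 M, (0 <? ent M 0 0)%BZ, psdb n.+1 1 M,
      all (fun i => ent M i i == ent M 0 i) (iota 0 n.+1),
      has (fun i => colok (col_of M i) && colok (cocol_of M i)) (iota 1 n)
    & all (fun i => ok (col_of M i) && ok (cocol_of M i)) (iota 1 n)].

Lemma lsb_sound P (colok : seq Z -> bool) M : convex P ->
  (forall v, colok v -> cone P (vecR v)) -> lsb colok M ->
  cone (LSplus P) (vecR (col_of M 0)).
Proof.
move=> cvxP okP /and5P[trM M00 psdM /allP dM /andP[/hasP[i0 i0n /andP[ok1 ok2]] /allP ok]].
have colE i : vecR (col_of M i) = \col_(j < 1 + n) zr (ent M i j).
  by apply/colP => j; rewrite !mxE nth_mkseq.
have cocolE i : vecR (cocol_of M i) = \col_(j < 1 + n) (zr (ent M 0 j) - zr (ent M i j)).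
  by apply/colP => j; rewrite !mxE nth_mkseq // zrB.
have C0 : cone P (vecR (col_of M 0)).
  have := convex_coneD cvxP (okP _ ok1) (okP _ ok2).
  suff -> : vecR (col_of M i0) + vecR (cocol_of M i0) = vecR (col_of M 0) by [].
  by rewrite !colE cocolE; apply/colP => j; rewrite !mxE addrC subrK.
have {okP}okP v : colok v || (v == col_of M 0) -> cone P (vecR v).
  by case/orP => [/okP|/eqP->].
have entC i j : ent M i j = ent M j i by rewrite /ent minnC maxnC.
have p0 := zr_gt0 R M00; set m := zr (ent M 0 0) in p0.
(* The integer matrix is divided by its entry at (0, 0), so that the first column becomes (1, x). *)
pose Z : 'M[R]_(1 + n) := \matrix_(i, j) zr (ent M i j).
pose Y := m^-1 *: Z.
have Ycol i : Y *m delta_mx i 0 = m^-1 *: vecR (col_of M i).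
  by rewrite -scalemxAl -matrix.colE colE; congr (_ *: _); apply/colP => j; rewrite !mxE entC.
apply: cone_vecR; rewrite !nth_mkseq //; set x := \col_i _.
exists Y; last first.
  rewrite Ycol colE; apply/colP => i; case: (split_ordP i) => j ->.
    by rewrite col_mxEu !mxE [j]ord1 /= mulVf // gt_eqF.
  by rewrite col_mxEd !mxE nth_mkseq ?ltnS ?ltn_ord // [LHS]mulrC.
split=> [||i]; [split=> [|z]| |].
- by apply/matrixP => i j; rewrite !mxE entC.
- rewrite -scalemxAr -scalemxAl mxE mulr_ge0 ?invr_ge0 ?(ltW p0) //.
  pose f k := if insub k is Some i then z (i : 'I_(1 + n)) 0 else 0.
  have fE (i : 'I_(1 + n)) : f i = z i 0 by rewrite /f valK.
  suff -> : (z^T *m Z *m z) 0 0 = qform M (mkseq f n.+1).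
    by apply: psdb_sound psdM _ => //; rewrite size_mkseq.
  rewrite qformE // mxE exchange_big /=; apply: eq_bigr => j _; rewrite mxE big_distrl /=.
  by apply: eq_bigr => i _; rewrite !mxE !fE; ring.
- rewrite Ycol colE; apply/colP => i; rewrite !mxE.
  have /dM/eqP -> // : (i : nat) \in iota 0 n.+1 by rewrite mem_iota add0n ltn_ord.
have /ok/andP[c c'] : i.+1 \in iota 1 n by rewrite mem_iota /= add1n ltnS ltn_ord.
have m0 : 0 <= m^-1 by rewrite invr_ge0 ltW.
rewrite mulmxBr !Ycol; split; first exact/cone_scale/okP.
rewrite -scalerBr; apply: cone_scale => //; have := okP _ c'.
suff -> : vecR (cocol_of M i.+1) = vecR (col_of M 0) - vecR (col_of M i.+1) by [].
by rewrite !colE cocolE; apply/colP => j; rewrite !mxE.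
Qed.

(* The columns of the matrices in [Ns] are looked up, modulo the endomorphisms
   [ss], among the stable set combinations [L] and the first columns of the
   matrices [Ms] of the level below. *)
Definition tower_step ss (L : seq (seq (Z * seq nat))) (Ms Ns : seq (seq (seq Z))) : bool :=
  all (lsb (matchb ss ([seq stab_vec l | l <- L] ++ [seq col_of M 0 | M <- Ms]))) Ns.

Lemma tower_step_sound k ss L Ms Ns : all homb ss -> all stabb L ->
  (forall M, M \in Ms -> cone (LSplus_iter k G) (vecR (col_of M 0))) ->
  tower_step ss L Ms Ns ->
  forall M, M \in Ns -> cone (LSplus_iter k.+1 G) (vecR (col_of M 0)).
Proof.
move=> hom /allP stL HMs /allP ok M MN.
apply: (lsb_sound (P := LSplus_iter k G)) (ok M MN); first exact: convex_LSplus_iter.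
move=> v; apply: matchb_sound => // w; rewrite mem_cat.
case/orP => [/mapP[l lL ->]|/mapP[M' /HMs H ->]] //.
by apply: (cone_sub (@STAB_sub_LSplus_iter _ _ G k)); apply: stabb_sound; apply: stL.
Qed.

(** The bottom of the tower: here the columns are tested against the inequalities of FRAC
    themselves. *)
Lemma lsb_FRAC_sound M : lsb fracb M -> cone (LSplus_iter 1 G) (vecR (col_of M 0)).
Proof. by apply: lsb_sound; [apply: convex_FRAC | apply: fracb_sound]. Qed.

End Certificates.

(** * The graph G_{4,1} *)

(** One automorphism for each permutation of the triangle 1, 2, 3, listed by images. The vertex
    orbits are the triangle, the three vertices with index 0, and the remaining six. *)
Definition G41_automorphisms : seq (seq nat) := [::
  [:: 0; 1; 2; 3; 4; 5; 6; 7; 8; 9; 10; 11];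
  [:: 0; 2; 1; 6; 8; 7; 3; 5; 4; 9; 11; 10];
  [:: 1; 0; 2; 9; 11; 10; 6; 8; 7; 3; 5; 4];
  [:: 1; 2; 0; 6; 7; 8; 9; 10; 11; 3; 4; 5];
  [:: 2; 0; 1; 9; 10; 11; 3; 4; 5; 6; 7; 8];
  [:: 2; 1; 0; 3; 5; 4; 9; 11; 10; 6; 8; 7]]%N.

(* Numerical data, obtained by rounding a strictly feasible solution of the
   semidefinite program maximizing the sum of x over symmetric x in LS_+^3
   (optimal value about 4.0027). All vectors are scaled by 20000. A pair (w, S)
   is w times the incidence vector of S. *)
Local Open Scope Z_scope.

Definition stable_combinations : seq (seq (Z * seq nat)) := [::
  [::];
  [:: (2025, [:: 0; 3; 6; 9]%N); (1562, [:: 0; 5; 6; 9]%N); (1562, [:: 0; 3; 7; 9]%N);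
      (1, [:: 0; 3; 6]%N)];
  [:: (2025, [:: 1; 3; 6; 9]%N); (1477, [:: 1; 3; 8; 9]%N); (1644, [:: 1; 3; 6; 10]%N);
      (1, [:: 1; 3; 6]%N); (2, [:: 1; 3; 9]%N); (1, [:: 1; 6; 9]%N)];
  [:: (1294, [:: 2; 4; 6; 9]%N); (1472, [:: 4; 5; 6; 9]%N); (85, [:: 4; 5; 7; 9]%N);
      (55, [:: 5; 7; 8; 9]%N); (141, [:: 2; 4; 6; 11]%N); (136, [:: 4; 6; 10; 11]%N);
      (4, [:: 2; 4; 6]%N); (4, [:: 2; 4; 9]%N); (1, [:: 1; 6; 9]%N); (36, [:: 2; 6; 9]%N);
      (38, [:: 4; 6; 9]%N)];
  [:: (1330, [:: 2; 4; 6; 9]%N); (1507, [:: 4; 5; 6; 9]%N); (52, [:: 4; 5; 7; 9]%N);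
      (141, [:: 2; 4; 6; 11]%N); (133, [:: 4; 6; 10; 11]%N); (3, [:: 2; 4; 6]%N);
      (3, [:: 2; 4; 9]%N); (5, [:: 4; 6; 9]%N)];
  [:: (1469, [:: 4; 5; 6; 9]%N); (87, [:: 4; 5; 7; 9]%N); (52, [:: 5; 7; 8; 9]%N);
      (2, [:: 4; 5; 6]%N); (1, [:: 4; 5; 9]%N); (1, [:: 5; 6; 9]%N)];
  [:: (1358, [:: 1; 3; 6; 10]%N); (275, [:: 1; 3; 8; 10]%N); (1362, [:: 2; 3; 6; 11]%N);
      (277, [:: 2; 4; 6; 11]%N); (1535, [:: 3; 6; 10; 11]%N); (6, [:: 1; 3; 6]%N);
      (6, [:: 2; 3; 6]%N); (2, [:: 5; 7; 8]%N); (4, [:: 1; 3; 10]%N); (2, [:: 1; 6; 10]%N)];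
  [:: (1364, [:: 1; 3; 6; 10]%N); (274, [:: 1; 3; 8; 10]%N); (1392, [:: 3; 6; 10; 11]%N);
      (133, [:: 4; 6; 10; 11]%N); (3, [:: 1; 3; 10]%N); (3, [:: 1; 6; 10]%N);
      (5, [:: 3; 6; 10]%N)];
  [:: (1951, [:: 0; 3; 6; 9]%N); (1635, [:: 0; 3; 7; 9]%N); (1, [:: 0; 3; 6]%N);
      (1, [:: 0; 3; 9]%N)];
  [:: (2147, [:: 1; 3; 6; 9]%N); (1500, [:: 1; 3; 8; 9]%N); (1500, [:: 1; 3; 6; 10]%N);
      (1, [:: 1; 3; 6]%N); (1, [:: 1; 3; 9]%N)];
  [:: (1596, [:: 0; 3; 7; 9]%N); (1486, [:: 1; 3; 8; 9]%N); (1478, [:: 3; 7; 8; 9]%N);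
      (2, [:: 1; 3; 8; 10]%N); (134, [:: 3; 8; 10; 11]%N); (26, [:: 0; 3; 7]%N);
      (14, [:: 0; 3; 9]%N); (13, [:: 1; 3; 9]%N); (1, [:: 2; 3; 9]%N)];
  [:: (1634, [:: 0; 3; 7; 9]%N); (1331, [:: 3; 7; 8; 9]%N); (133, [:: 3; 7; 8; 10]%N);
      (1, [:: 0; 3; 7]%N); (1, [:: 3; 7; 9]%N)];
  [:: (1497, [:: 1; 3; 8; 9]%N); (1464, [:: 3; 7; 8; 9]%N); (133, [:: 3; 8; 10; 11]%N);
      (3, [:: 1; 3; 8]%N); (3, [:: 3; 8; 9]%N)];
  [:: (1537, [:: 2; 4; 6; 9]%N); (1545, [:: 0; 5; 6; 9]%N); (1555, [:: 4; 5; 6; 9]%N);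
      (74, [:: 5; 7; 8; 9]%N); (74, [:: 4; 6; 10; 11]%N); (4, [:: 2; 4; 6]%N);
      (4, [:: 2; 4; 9]%N); (17, [:: 0; 6; 9]%N); (1, [:: 1; 6; 9]%N); (17, [:: 2; 6; 9]%N)];
  [:: (1556, [:: 2; 4; 6; 9]%N); (1466, [:: 4; 5; 6; 9]%N); (71, [:: 4; 5; 7; 9]%N);
      (71, [:: 4; 6; 10; 11]%N); (3, [:: 2; 4; 6]%N); (3, [:: 2; 4; 9]%N); (4, [:: 4; 6; 9]%N)];
  [:: (1964, [:: 0; 3; 6; 9]%N); (1632, [:: 0; 5; 6; 9]%N); (1548, [:: 0; 3; 7; 9]%N);
      (2, [:: 0; 3; 6]%N); (2, [:: 0; 3; 9]%N); (2, [:: 0; 6; 9]%N)];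
  [:: (2120, [:: 1; 3; 6; 9]%N); (1512, [:: 1; 3; 8; 9]%N); (1512, [:: 1; 3; 6; 10]%N);
      (2, [:: 1; 3; 6]%N); (2, [:: 1; 3; 9]%N); (2, [:: 1; 6; 9]%N)];
  [:: (1968, [:: 2; 3; 6; 9]%N); (1614, [:: 2; 3; 6; 11]%N); (2, [:: 2; 3; 6]%N);
      (2, [:: 2; 3; 9]%N); (2, [:: 2; 6; 9]%N)];
  [:: (697, [:: 0; 5; 6; 9]%N); (912, [:: 0; 5; 7; 9]%N); (4, [:: 5; 7; 8; 9]%N);
      (3, [:: 0; 5; 6]%N); (11, [:: 0; 5; 9]%N); (11, [:: 0; 6; 9]%N); (6, [:: 5; 6; 9]%N);
      (2, [:: 1; 6; 10]%N); (2, [:: 7; 8; 10]%N); (2, [:: 2; 6; 11]%N); (4, [:: 5; 6; 11]%N)];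
  [:: (704, [:: 0; 5; 6; 9]%N); (916, [:: 0; 5; 7; 9]%N); (5, [:: 0; 5; 6]%N);
      (7, [:: 0; 5; 9]%N); (5, [:: 5; 6; 9]%N)];
  [:: (587, [:: 0; 3; 7; 9]%N); (923, [:: 0; 5; 7; 9]%N); (1486, [:: 1; 3; 8; 9]%N);
      (1581, [:: 3; 7; 8; 9]%N); (107, [:: 3; 8; 10; 11]%N); (6, [:: 0; 3; 7]%N);
      (28, [:: 0; 3; 9]%N); (28, [:: 1; 3; 9]%N); (2, [:: 2; 3; 9]%N); (6, [:: 0; 7; 9]%N)];
  [:: (629, [:: 0; 3; 7; 9]%N); (916, [:: 0; 5; 7; 9]%N); (1451, [:: 3; 7; 8; 9]%N);
      (102, [:: 3; 7; 8; 10]%N); (1, [:: 0; 3; 7]%N); (2, [:: 0; 7; 9]%N); (2, [:: 3; 7; 9]%N)];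
  [:: (1501, [:: 1; 3; 8; 9]%N); (1553, [:: 3; 7; 8; 9]%N); (102, [:: 3; 8; 10; 11]%N);
      (5, [:: 1; 3; 8]%N); (6, [:: 1; 8; 9]%N); (7, [:: 3; 8; 9]%N)];
  [:: (1468, [:: 1; 3; 6; 10]%N); (6, [:: 1; 3; 8; 10]%N); (96, [:: 3; 7; 8; 10]%N);
      (1582, [:: 2; 3; 6; 11]%N); (1521, [:: 3; 6; 10; 11]%N); (28, [:: 1; 3; 6]%N);
      (34, [:: 2; 3; 6]%N); (2, [:: 0; 3; 7]%N); (5, [:: 5; 7; 8]%N); (4, [:: 1; 3; 10]%N);
      (8, [:: 1; 6; 10]%N)];
  [:: (1503, [:: 1; 3; 6; 10]%N); (102, [:: 3; 7; 8; 10]%N); (1482, [:: 3; 6; 10; 11]%N);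
      (5, [:: 1; 3; 10]%N); (4, [:: 1; 6; 10]%N); (7, [:: 3; 6; 10]%N)];
  [:: (1603, [:: 2; 3; 6; 11]%N); (1380, [:: 3; 6; 10; 11]%N); (102, [:: 3; 8; 10; 11]%N);
      (5, [:: 2; 3; 11]%N); (6, [:: 2; 6; 11]%N); (7, [:: 3; 6; 11]%N)]].

Definition level1_matrices : seq (seq (seq Z)) := [::
  [:: [:: 9700; 0; 0; 5150; 6435; 3174; 1612; 7913; 1612; 1697; 6518; 1530; 3174];
      [:: 0; 0; 0; 0; 0; 0; 0; 0; 0; 0; 0; 0]; [:: 0; 0; 0; 0; 0; 0; 0; 0; 0; 0; 0];
      [:: 5150; 3960; 1189; 0; 5149; 0; 0; 3966; 0; 1182];
      [:: 6435; 0; 0; 4798; 1463; 1635; 4519; 1048; 1915];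
      [:: 3174; 1550; 3113; 59; 0; 1955; 481; 1217]; [:: 1612; 1463; 147; 60; 1105; 0; 506];
      [:: 7913; 0; 0; 4895; 1383; 3017]; [:: 1612; 1551; 1608; 2; 0]; [:: 1697; 1550; 146; 144];
      [:: 6518; 0; 0]; [:: 1530; 1526]; [:: 3174]];
  [:: [:: 11584; 0; 5149; 3671; 11584; 0; 0; 8462; 1472; 3119; 7038; 3038; 2897];
      [:: 0; 0; 0; 0; 0; 0; 0; 0; 0; 0; 0; 0];
      [:: 5149; 0; 5149; 0; 0; 3947; 0; 1201; 4024; 1124; 0];
      [:: 3671; 3671; 0; 0; 3670; 0; 0; 2408; 0; 1262];
      [:: 11584; 0; 0; 8462; 1472; 3119; 7038; 3038; 2897]; [:: 0; 0; 0; 0; 0; 0; 0; 0];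
      [:: 0; 0; 0; 0; 0; 0; 0]; [:: 8462; 0; 0; 5484; 1853; 2171]; [:: 1472; 1471; 878; 593; 0];
      [:: 3119; 1553; 1184; 725]; [:: 7038; 0; 0]; [:: 3038; 1634]; [:: 2897]];
  [:: [:: 11676; 0; 5150; 3673; 11584; 0; 53; 8465; 1560; 3174; 7126; 3041; 2900];
      [:: 0; 0; 0; 0; 0; 0; 0; 0; 0; 0; 0; 0];
      [:: 5150; 0; 5140; 0; 0; 3964; 0; 1176; 4009; 1132; 0];
      [:: 3673; 3663; 0; 0; 3664; 0; 0; 2423; 0; 1241];
      [:: 11584; 0; 0; 8454; 1507; 3120; 7072; 3031; 2890]; [:: 0; 0; 0; 0; 0; 0; 0; 0];
      [:: 53; 0; 44; 44; 44; 0; 0]; [:: 8465; 0; 0; 5473; 1895; 2160];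
      [:: 1560; 1551; 977; 574; 0]; [:: 3174; 1644; 1137; 731]; [:: 7126; 0; 0];
      [:: 3041; 1650]; [:: 2900]];
  [:: [:: 13238; 0; 5150; 5150; 11584; 1615; 0; 10112; 1473; 3122; 8413; 3174; 3174];
      [:: 0; 0; 0; 0; 0; 0; 0; 0; 0; 0; 0; 0];
      [:: 5150; 0; 5140; 0; 0; 3946; 0; 1202; 4045; 1104; 0];
      [:: 5150; 3868; 1276; 0; 5149; 0; 0; 3791; 0; 1358];
      [:: 11584; 0; 0; 8483; 1464; 3100; 8013; 2885; 2002];
      [:: 1615; 0; 1614; 0; 0; 389; 279; 1164]; [:: 0; 0; 0; 0; 0; 0; 0];
      [:: 10112; 0; 0; 6819; 2012; 2463]; [:: 1473; 1472; 862; 610; 0];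
      [:: 3122; 1593; 1161; 709]; [:: 8413; 0; 0]; [:: 3174; 1815]; [:: 3174]];
  [:: [:: 10023; 0; 3505; 3505; 7038; 2897; 1610; 7038; 1610; 2897; 10023; 0; 0];
      [:: 0; 0; 0; 0; 0; 0; 0; 0; 0; 0; 0; 0];
      [:: 3505; 0; 3504; 0; 0; 2164; 0; 1340; 3505; 0; 0];
      [:: 3505; 2164; 1340; 0; 3504; 0; 0; 3505; 0; 0];
      [:: 7038; 0; 0; 4194; 1470; 2843; 7038; 0; 0]; [:: 2897; 1556; 2843; 53; 0; 2897; 0; 0];
      [:: 1610; 1470; 139; 53; 1610; 0; 0]; [:: 7038; 0; 0; 7038; 0; 0];
      [:: 1610; 1556; 1610; 0; 0]; [:: 2897; 2897; 0; 0]; [:: 10023; 0; 0]; [:: 0; 0]; [:: 0]];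
  [:: [:: 11676; 0; 3506; 5150; 8546; 3041; 1612; 8687; 1612; 2900; 10023; 0; 1649];
      [:: 0; 0; 0; 0; 0; 0; 0; 0; 0; 0; 0; 0];
      [:: 3506; 0; 3505; 0; 0; 2163; 0; 1342; 3505; 0; 0];
      [:: 5150; 3666; 1483; 0; 5149; 0; 0; 3861; 0; 1288];
      [:: 8546; 0; 0; 5700; 1470; 2845; 8049; 0; 496];
      [:: 3041; 1557; 2986; 54; 0; 1896; 0; 1144]; [:: 1612; 1470; 141; 54; 1255; 0; 356];
      [:: 8687; 0; 0; 7324; 0; 1362]; [:: 1612; 1557; 1611; 0; 0]; [:: 2900; 2621; 0; 278];
      [:: 10023; 0; 0]; [:: 0; 0]; [:: 1649]];
  [:: [:: 11584; 0; 5149; 3588; 11584; 0; 0; 8470; 1465; 3100; 6835; 3100; 3100];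
      [:: 0; 0; 0; 0; 0; 0; 0; 0; 0; 0; 0; 0];
      [:: 5149; 0; 5149; 0; 0; 3970; 0; 1175; 4034; 1111; 0];
      [:: 3588; 3588; 0; 0; 3584; 0; 0; 2206; 0; 1377];
      [:: 11584; 0; 0; 8470; 1465; 3100; 6835; 3100; 3100]; [:: 0; 0; 0; 0; 0; 0; 0; 0];
      [:: 0; 0; 0; 0; 0; 0; 0]; [:: 8470; 0; 0; 5308; 1914; 2354]; [:: 1465; 1461; 868; 593; 0];
      [:: 3100; 1522; 1181; 741]; [:: 6835; 0; 0]; [:: 3100; 1718]; [:: 3100]];
  [:: [:: 10023; 3588; 0; 3588; 10023; 0; 0; 6774; 3100; 1600; 6774; 1600; 3100];
      [:: 3588; 0; 0; 3588; 0; 0; 1987; 1600; 0; 3587; 0; 0];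
      [:: 0; 0; 0; 0; 0; 0; 0; 0; 0; 0; 0]; [:: 3588; 3588; 0; 0; 3587; 0; 0; 1987; 0; 1600];
      [:: 10023; 0; 0; 6774; 3100; 1600; 6774; 1600; 3100]; [:: 0; 0; 0; 0; 0; 0; 0; 0];
      [:: 0; 0; 0; 0; 0; 0; 0]; [:: 6774; 0; 0; 3774; 1352; 2999];
      [:: 3100; 1499; 2999; 100; 0]; [:: 1600; 1352; 247; 100]; [:: 6774; 0; 0];
      [:: 1600; 1499]; [:: 3100]];
  [:: [:: 10422; 1952; 3648; 3587; 10422; 0; 0; 10422; 0; 0; 5834; 2964; 2966];
      [:: 1952; 0; 0; 1952; 0; 0; 1952; 0; 0; 1951; 0; 0];
      [:: 3648; 0; 3648; 0; 0; 3648; 0; 0; 2169; 1478; 0];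
      [:: 3587; 3587; 0; 0; 3587; 0; 0; 2106; 0; 1480];
      [:: 10422; 0; 0; 10422; 0; 0; 5834; 2964; 2966]; [:: 0; 0; 0; 0; 0; 0; 0; 0];
      [:: 0; 0; 0; 0; 0; 0; 0]; [:: 10422; 0; 0; 5834; 2964; 2966]; [:: 0; 0; 0; 0; 0];
      [:: 0; 0; 0; 0]; [:: 5834; 0; 0]; [:: 2964; 1485]; [:: 2966]];
  [:: [:: 12072; 1953; 5149; 3588; 12072; 0; 0; 10422; 0; 1636; 7456; 2967; 3100];
      [:: 1953; 0; 0; 1953; 0; 0; 1949; 0; 0; 1949; 0; 0];
      [:: 5149; 0; 5149; 0; 0; 3829; 0; 1316; 3796; 1348; 0];
      [:: 3588; 3588; 0; 0; 3584; 0; 0; 2102; 0; 1481];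
      [:: 12072; 0; 0; 10422; 0; 1636; 7456; 2967; 3100]; [:: 0; 0; 0; 0; 0; 0; 0; 0];
      [:: 0; 0; 0; 0; 0; 0; 0]; [:: 10422; 0; 0; 7013; 1825; 2817]; [:: 0; 0; 0; 0; 0];
      [:: 1636; 439; 1138; 279]; [:: 7456; 0; 0]; [:: 2967; 1614]; [:: 3100]];
  [:: [:: 12072; 3588; 3649; 3588; 12072; 0; 0; 10422; 1636; 0; 7458; 2967; 2967];
      [:: 3588; 0; 0; 3588; 0; 0; 1952; 1632; 0; 3584; 0; 0];
      [:: 3649; 0; 3649; 0; 0; 3645; 0; 0; 2156; 1489; 0];
      [:: 3588; 3588; 0; 0; 3584; 0; 0; 2095; 0; 1489];
      [:: 12072; 0; 0; 10422; 1636; 0; 7458; 2967; 2967]; [:: 0; 0; 0; 0; 0; 0; 0; 0];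
      [:: 0; 0; 0; 0; 0; 0; 0]; [:: 10422; 0; 0; 5822; 2963; 2963]; [:: 1636; 0; 1632; 0; 0];
      [:: 0; 0; 0; 0]; [:: 7458; 0; 0]; [:: 2967; 1474]; [:: 2967]];
  [:: [:: 11676; 0; 5150; 3588; 11656; 0; 5; 8472; 1555; 3174; 6924; 3103; 3103];
      [:: 0; 0; 0; 0; 0; 0; 0; 0; 0; 0; 0; 0];
      [:: 5150; 0; 5147; 0; 0; 3981; 0; 1164; 4008; 1139; 0];
      [:: 3588; 3585; 0; 0; 3581; 0; 0; 2207; 0; 1377];
      [:: 11656; 0; 0; 8469; 1550; 3169; 6919; 3100; 3100]; [:: 0; 0; 0; 0; 0; 0; 0; 0];
      [:: 5; 0; 2; 2; 2; 0; 0]; [:: 8472; 0; 0; 5296; 1948; 2347]; [:: 1555; 1549; 962; 590; 0];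
      [:: 3174; 1621; 1148; 751]; [:: 6924; 0; 0]; [:: 3103; 1722]; [:: 3103]];
  [:: [:: 11676; 5150; 0; 3588; 10024; 0; 1637; 8436; 3103; 1662; 8436; 1591; 3103];
      [:: 5150; 0; 0; 3872; 0; 1275; 3621; 1527; 0; 5148; 0; 0];
      [:: 0; 0; 0; 0; 0; 0; 0; 0; 0; 0; 0]; [:: 3588; 3583; 0; 0; 3586; 0; 0; 1988; 0; 1598];
      [:: 10024; 0; 0; 7926; 1979; 1303; 7083; 1586; 2824]; [:: 0; 0; 0; 0; 0; 0; 0; 0];
      [:: 1637; 505; 1119; 355; 1348; 0; 275]; [:: 8436; 0; 0; 5419; 1370; 3015];
      [:: 3103; 1574; 3015; 86; 0]; [:: 1662; 1441; 220; 86]; [:: 8436; 0; 0]; [:: 1591; 1503];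
      [:: 3103]];
  [:: [:: 13238; 5150; 5150; 0; 11586; 0; 1637; 8486; 3103; 3174; 10100; 3103; 1489];
      [:: 5150; 0; 0; 3881; 0; 1264; 3856; 1289; 0; 5141; 0; 0];
      [:: 5150; 0; 5145; 0; 0; 4045; 0; 1100; 3954; 1189; 0]; [:: 0; 0; 0; 0; 0; 0; 0; 0; 0; 0];
      [:: 11586; 0; 0; 8056; 1963; 2872; 8476; 3098; 1479]; [:: 0; 0; 0; 0; 0; 0; 0; 0];
      [:: 1637; 425; 1136; 297; 1619; 0; 5]; [:: 8486; 0; 0; 6882; 1595; 876];
      [:: 3103; 1809; 2397; 699; 0]; [:: 3174; 2012; 1152; 609]; [:: 10100; 0; 0];
      [:: 3103; 1476]; [:: 1489]];
  [:: [:: 15172; 3516; 5148; 3586; 15172; 0; 0; 11347; 2185; 3168; 10431; 3099; 3097];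
      [:: 3516; 0; 0; 3516; 0; 0; 2975; 512; 0; 3488; 0; 0];
      [:: 5148; 0; 5148; 0; 0; 4250; 0; 869; 4607; 513; 0];
      [:: 3586; 3586; 0; 0; 3558; 0; 0; 2164; 0; 1394];
      [:: 15172; 0; 0; 11347; 2185; 3168; 10431; 3099; 3097]; [:: 0; 0; 0; 0; 0; 0; 0; 0];
      [:: 0; 0; 0; 0; 0; 0; 0]; [:: 11347; 0; 0; 8846; 1489; 2015];
      [:: 2185; 1644; 761; 1396; 0]; [:: 3168; 1511; 1582; 1054]; [:: 10431; 0; 0];
      [:: 3099; 1675]; [:: 3097]];
  [:: [:: 15189; 3518; 5150; 3588; 15172; 0; 0; 11358; 2187; 3174; 10440; 3103; 3103];
      [:: 3518; 0; 0; 3512; 0; 0; 3023; 469; 0; 3463; 0; 0];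
      [:: 5150; 0; 5144; 0; 0; 4048; 0; 1072; 4072; 1045; 0];
      [:: 3588; 3582; 0; 0; 3529; 0; 0; 2235; 0; 1322];
      [:: 15172; 0; 0; 11352; 2181; 3168; 10434; 3097; 3097]; [:: 0; 0; 0; 0; 0; 0; 0; 0];
      [:: 0; 0; 0; 0; 0; 0; 0]; [:: 11358; 0; 0; 8503; 1868; 2264];
      [:: 2187; 1689; 1409; 744; 0]; [:: 3174; 1802; 1148; 802]; [:: 10440; 0; 0];
      [:: 3103; 1743]; [:: 3103]];
  [:: [:: 12072; 3600; 3636; 3586; 11347; 0; 714; 12072; 0; 0; 7431; 2996; 2996];
      [:: 3600; 0; 0; 2885; 0; 712; 3600; 0; 0; 3598; 0; 0];
      [:: 3636; 0; 3633; 0; 0; 3636; 0; 0; 2138; 1496; 0];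
      [:: 3586; 3583; 0; 0; 3586; 0; 0; 2088; 0; 1496];
      [:: 11347; 0; 0; 11347; 0; 0; 6716; 2993; 2993]; [:: 0; 0; 0; 0; 0; 0; 0; 0];
      [:: 714; 714; 0; 0; 712; 0; 0]; [:: 12072; 0; 0; 7431; 2996; 2996]; [:: 0; 0; 0; 0; 0];
      [:: 0; 0; 0; 0]; [:: 7431; 0; 0]; [:: 2996; 1498]; [:: 2996]];
  [:: [:: 13723; 3602; 5150; 3588; 12987; 0; 721; 12072; 0; 1621; 9072; 3001; 3103];
      [:: 3602; 0; 0; 2881; 0; 717; 3594; 0; 0; 3598; 0; 0];
      [:: 5150; 0; 5146; 0; 0; 3853; 0; 1290; 3767; 1379; 0];
      [:: 3588; 3584; 0; 0; 3579; 0; 0; 2103; 0; 1481];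
      [:: 12987; 0; 0; 11360; 0; 1615; 8351; 2997; 3099]; [:: 0; 0; 0; 0; 0; 0; 0; 0];
      [:: 721; 706; 0; 0; 717; 0; 0]; [:: 12072; 0; 0; 8614; 1871; 2797]; [:: 0; 0; 0; 0; 0];
      [:: 1621; 449; 1123; 299]; [:: 9072; 0; 0]; [:: 3001; 1618]; [:: 3103]];
  [:: [:: 13652; 5150; 3638; 3588; 12004; 0; 1637; 12072; 1550; 0; 9005; 3001; 3001];
      [:: 5150; 0; 0; 3513; 0; 1634; 3598; 1547; 0; 5147; 0; 0];
      [:: 3638; 0; 3635; 0; 0; 3629; 0; 0; 2145; 1490; 0];
      [:: 3588; 3585; 0; 0; 3579; 0; 0; 2095; 0; 1490];
      [:: 12004; 0; 0; 11984; 0; 0; 7368; 2998; 2998]; [:: 0; 0; 0; 0; 0; 0; 0; 0];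
      [:: 1637; 83; 1547; 0; 1634; 0; 0]; [:: 12072; 0; 0; 7451; 2992; 2992];
      [:: 1550; 0; 1547; 0; 0]; [:: 0; 0; 0; 0]; [:: 9005; 0; 0]; [:: 3001; 1508]; [:: 3001]];
  [:: [:: 12072; 5148; 3636; 1972; 10431; 0; 1632; 7431; 3000; 3067; 12072; 0; 0];
      [:: 5148; 0; 0; 3830; 0; 1316; 3730; 1417; 0; 5148; 0; 0];
      [:: 3636; 0; 3634; 0; 0; 2151; 0; 1484; 3636; 0; 0];
      [:: 1972; 1970; 0; 0; 1970; 0; 0; 1972; 0; 0];
      [:: 10431; 0; 0; 6989; 1865; 2790; 10431; 0; 0]; [:: 0; 0; 0; 0; 0; 0; 0; 0];
      [:: 1632; 439; 1132; 275; 1632; 0; 0]; [:: 7431; 0; 0; 7431; 0; 0];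
      [:: 3000; 1582; 3000; 0; 0]; [:: 3067; 3067; 0; 0]; [:: 12072; 0; 0]; [:: 0; 0]; [:: 0]];
  [:: [:: 13723; 5150; 3638; 3588; 12073; 0; 1637; 9076; 3001; 3072; 12072; 0; 1621];
      [:: 5150; 0; 0; 3840; 0; 1306; 3738; 1408; 0; 5141; 0; 0];
      [:: 3638; 0; 3634; 0; 0; 2155; 0; 1479; 3629; 0; 0];
      [:: 3588; 3584; 0; 0; 3584; 0; 0; 1965; 0; 1617];
      [:: 12073; 0; 0; 8622; 1862; 2773; 10443; 0; 1617]; [:: 0; 0; 0; 0; 0; 0; 0; 0];
      [:: 1637; 450; 1136; 295; 1624; 0; 0]; [:: 9076; 0; 0; 7451; 0; 1617];
      [:: 3001; 1589; 2992; 0; 0]; [:: 3072; 3062; 0; 0]; [:: 12072; 0; 0]; [:: 0; 0];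
      [:: 1621]];
  [:: [:: 13723; 5150; 5150; 1974; 12075; 0; 1637; 9076; 3103; 3072; 12072; 1621; 0];
      [:: 5150; 0; 0; 3841; 0; 1306; 3746; 1400; 0; 5142; 0; 0];
      [:: 5150; 0; 5147; 0; 0; 3777; 0; 1369; 3852; 1292; 0];
      [:: 1974; 1971; 0; 0; 1971; 0; 0; 1966; 0; 0];
      [:: 12075; 0; 0; 8649; 1943; 2780; 10445; 1617; 0]; [:: 0; 0; 0; 0; 0; 0; 0; 0];
      [:: 1637; 424; 1156; 289; 1623; 0; 0]; [:: 9076; 0; 0; 8639; 428; 0];
      [:: 3103; 1699; 2805; 291; 0]; [:: 3072; 1926; 1139; 0]; [:: 12072; 0; 0]; [:: 1621; 0];
      [:: 0]]].

(** With Y the level 3 matrix, the first columns are Y(e_0 - e_1), Ye_i for the vertex i = 4_0, and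
    Y(e_0 - e_j) for the vertex j = 4_1. The complementary vectors Ye_1, Y(e_0 - e_i) and Ye_j are
    combinations of stable sets. *)
Definition level2_matrices : seq (seq (seq Z)) := [::
  [:: [:: 14850; 0; 5150; 5150; 11584; 3174; 1612; 11584; 1612; 3174; 10023; 3174; 3174];
      [:: 0; 0; 0; 0; 0; 0; 0; 0; 0; 0; 0; 0];
      [:: 5150; 0; 5149; 0; 0; 3671; 0; 1477; 3505; 1644; 0];
      [:: 5150; 3671; 1477; 0; 5149; 0; 0; 3505; 0; 1644];
      [:: 11584; 0; 0; 8462; 1472; 3119; 7038; 3038; 2897];
      [:: 3174; 1559; 3119; 52; 0; 2897; 133; 274]; [:: 1612; 1472; 139; 52; 1610; 0; 0];
      [:: 11584; 0; 0; 7038; 2897; 3038]; [:: 1612; 1559; 1610; 0; 0];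
      [:: 3174; 2897; 274; 133]; [:: 10023; 0; 0]; [:: 3174; 1525]; [:: 3174]];
  [:: [:: 15172; 3588; 5149; 3588; 15172; 0; 0; 10422; 3100; 3100; 10422; 3100; 3100];
      [:: 3588; 0; 0; 3588; 0; 0; 1952; 1635; 0; 3587; 0; 0];
      [:: 5149; 0; 5149; 0; 0; 3648; 0; 1500; 3648; 1500; 0];
      [:: 3588; 3588; 0; 0; 3587; 0; 0; 1952; 0; 1635];
      [:: 15172; 0; 0; 10422; 3100; 3100; 10422; 3100; 3100]; [:: 0; 0; 0; 0; 0; 0; 0; 0];
      [:: 0; 0; 0; 0; 0; 0; 0]; [:: 10422; 0; 0; 5834; 2964; 2966];
      [:: 3100; 1464; 2966; 133; 0]; [:: 3100; 2964; 133; 133]; [:: 10422; 0; 0];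
      [:: 3100; 1464]; [:: 3100]];
  [:: [:: 16826; 5150; 5150; 3588; 15172; 0; 1637; 12072; 3103; 3174; 12072; 3103; 3103];
      [:: 5150; 0; 0; 3516; 0; 1632; 3600; 1548; 0; 5148; 0; 0];
      [:: 5150; 0; 5148; 0; 0; 3636; 0; 1512; 3636; 1512; 0];
      [:: 3588; 3586; 0; 0; 3586; 0; 0; 1972; 0; 1614];
      [:: 15172; 0; 0; 11347; 2185; 3168; 10431; 3099; 3097]; [:: 0; 0; 0; 0; 0; 0; 0; 0];
      [:: 1637; 714; 916; 0; 1632; 0; 0]; [:: 12072; 0; 0; 7431; 2996; 2996];
      [:: 3103; 1553; 3000; 102; 0]; [:: 3174; 3067; 102; 102]; [:: 12072; 0; 0];
      [:: 3103; 1482]; [:: 3103]]].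

(** The entries of row 0 after the leading 20000 sum to 80010, just above 4 times 20000. *)
Definition level3_matrix : seq (seq Z) :=
  [:: [:: 20000; 5150; 5150; 5150; 15172; 3174; 3174; 15172; 3174; 3174; 15172; 3174; 3174];
      [:: 5150; 0; 0; 3588; 0; 1562; 3588; 1562; 0; 5149; 0; 0];
      [:: 5150; 0; 5149; 0; 0; 3588; 0; 1562; 3588; 1562; 0];
      [:: 5150; 3588; 1562; 0; 5149; 0; 0; 3588; 0; 1562];
      [:: 15172; 0; 0; 10422; 3100; 3100; 10422; 3100; 3100];
      [:: 3174; 1537; 3100; 71; 0; 3100; 71; 71]; [:: 3174; 3100; 71; 71; 3100; 0; 71];
      [:: 15172; 0; 0; 10422; 3100; 3100]; [:: 3174; 1537; 3100; 71; 0];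
      [:: 3174; 3100; 71; 71]; [:: 15172; 0; 0]; [:: 3174; 1537]; [:: 3174]].

Local Close Scope Z_scope.

Definition G41_edges_nat : seq (nat * nat) :=
  [seq (e.1 : nat, e.2 : nat) | e : 'I_12 * 'I_12 <- G41_edges].

Lemma G41_adjE (i j : 'I_12) :
  G41 i j = ((i : nat, j : nat) \in G41_edges_nat) || ((j : nat, i : nat) \in G41_edges_nat).
Proof.
have inj : injective (fun e : 'I_12 * 'I_12 => (e.1 : nat, e.2 : nat)).
  by move=> [a b] [c d] [/val_inj -> /val_inj ->].
by rewrite /= /G41_adj -!(mem_map inj).
Qed.

(** * Stability number of the graph *)

Fixpoint forall_bits m (p : seq bool -> bool) : bool :=
  if m is m'.+1 then
    forall_bits m' (fun s => p (true :: s)) && forall_bits m' (fun s => p (false :: s))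
  else p [::].

Lemma forall_bitsP m (p : seq bool -> bool) s : forall_bits m p -> size s = m -> p s.
Proof.
elim: m p s => [|m IH] p [|b s] //= /andP[pt pf] [sz].
by case: b; [apply: (IH (fun s => p (true :: s))) | apply: (IH (fun s => p (false :: s)))].
Qed.

(** Exhaustive evaluation over the 4096 vertex subsets, coded as bit lists. *)
Lemma G41_stable_le4 :
  forall_bits 12 (fun s =>
    all (fun e => ~~ (nth false s e.1 && nth false s e.2)) G41_edges_nat ==>
    (count (nth false s) (iota 0 12) <= 4)%N).
Proof. by vm_compute. Qed.

Lemma G41_stable_card (S : {set 'I_12}) : stable G41 S -> (#|S| <= 4)%N.
Proof.
move=> stS; pose f k := if insub k is Some i then (i : 'I_12) \in S else false.
have fE (i : 'I_12) : f i = (i \in S) by rewrite /f valK.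
have := forall_bitsP G41_stable_le4 (size_mkseq f 12).
have fn k : (k < 12)%N -> nth false (mkseq f 12) k = f k by move=> k12; rewrite nth_mkseq.
have -> : all (fun e => ~~ (nth false (mkseq f 12) e.1 && nth false (mkseq f 12) e.2))
    G41_edges_nat.
  apply/allP => _ /mapP[[i j] ijE ->] /=; rewrite !fn // !fE.
  by apply/negP => /andP[iS jS]; have := stS i j iS jS; rewrite /= /G41_adj ijE.
rewrite implyTb (@eq_in_count _ _ f) => [|k]; last by rewrite mem_iota => /andP[_]; apply: fn.
by rewrite -sum1_count -/(index_iota 0 12) big_mkord -sum1_card (eq_bigl _ _ fE).
Qed.

Lemma STAB_G41_sum (R : realType) (x : 'cV[R]_12) : STAB G41 x -> \sum_i x i 0 <= 4.
Proof.
apply: (convex_hull_sub (P := [set x : 'cV[R]_12 | \sum_i x i 0 <= 4])) => [y z a|_ [S stS ->]] /=.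
  move=> /andP[a0 a1] y4 z4; under eq_bigr do rewrite !mxE.
  by rewrite big_split /= -!mulr_sumr; nra.
under eq_bigr do rewrite mxE.
by rewrite -natr_sum ler_nat -big_mkcond sum1_card G41_stable_card.
Qed.

Lemma zr_sum (R : realType) (s : seq Z) :
  \sum_(i < size s) zr R (nth 0%BZ s i) = zr R (foldr Z.add 0%BZ s).
Proof.
elim: s => [|z s IH]; first by rewrite big_ord0.
by rewrite big_ord_recl /= zrD -IH.
Qed.

(** * Evaluation of the certificates and the rank *)

Lemma automorphisms_check : all (homb 12 G41_edges_nat) G41_automorphisms.
Proof. by vm_compute. Qed.

Lemma stable_combinations_check : all (stabb G41_edges_nat) stable_combinations.
Proof. by vm_compute. Qed.

Lemma level1_check : all (lsb 12 (fracb 12 G41_edges_nat)) level1_matrices.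
Proof. by vm_compute. Qed.

Lemma level2_check :
  tower_step 12 G41_automorphisms stable_combinations level1_matrices level2_matrices.
Proof. by vm_compute. Qed.

Lemma level3_check :
  tower_step 12 G41_automorphisms stable_combinations level2_matrices [:: level3_matrix].
Proof. by vm_compute. Qed.

Lemma level1_certified (R : realType) M : M \in level1_matrices ->
  cone (LSplus_iter 1 G41) (vecR R 12 (col_of 12 M 0)).
Proof. by move=> /(allP level1_check); apply: lsb_FRAC_sound G41_adjE _. Qed.

Lemma level2_certified (R : realType) M : M \in level2_matrices ->
  cone (LSplus_iter 2 G41) (vecR R 12 (col_of 12 M 0)).
Proof.
exact: (tower_step_sound G41_adjE automorphisms_check stable_combinations_check
  (@level1_certified R) level2_check).
Qed.

Lemma level3_certified (R : realType) :
  cone (LSplus_iter 3 G41) (vecR R 12 (col_of 12 level3_matrix 0)).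
Proof.
exact: (tower_step_sound G41_adjE automorphisms_check stable_combinations_check
  (@level2_certified R) level3_check (mem_head _ _)).
Qed.

Theorem theorem22 (R : realType) : is_LSplus_rank R G41 4.
Proof.
(* The upper bound applies because 12 <= 3 * 4 + 2. *)
split=> [|j j4 jST]; first exact: LSplus_iter_STAB.
(* The iterates decrease, so equality with STAB at some [j <= 3] would place the third iterate
   inside STAB. *)
have sub3 : LSplus_iter 3 G41 `<=` STAB (R := R) G41.
  by rewrite -jST; apply: LSplus_iter_subset.
have v0 : (0 <? ent level3_matrix 0 0)%BZ by vm_compute.
have [|x /sub3/STAB_G41_sum x4 /colP vx] := coneP (zr_gt0 R v0) (level3_certified R).
  by rewrite mxE nth_mkseq.
set v := col_of 12 level3_matrix 0 in vx.
have vE (i : 'I_12) : zr R (nth 0%BZ (behead v) i) = zr R (ent level3_matrix 0 0) * x i 0.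
  by have := vx (rshift 1 i); rewrite col_mxEd !mxE nth_behead.
have : zr R (foldr Z.add 0%BZ (behead v)) <= zr R (4 * ent level3_matrix 0 0)%BZ.
  rewrite -zr_sum; under eq_bigr do rewrite vE.
  by rewrite -mulr_sumr zrM mulrC ler_wpM2r // ltW // zr_gt0.
(* The contradiction is the integer comparison 80000 < 80010. *)
by apply/negP; rewrite -ltNge zr_lt //; vm_compute.
Qed.
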